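(* Let $c$ be a piecewise constant wave speed with jump points $x_1<\cdots<x_n$ and values $c_0,\dots,c_n$ (see context), and suppose that the jump points are equally spaced with respect to travel time, i.e. there is a fixed value $\Delta_0$ such that $$\frac{x_j-x_{j-1}}{c_{j-1}}=\Delta_0\qquad(1\le j\le n)$$ (where $c_j=c_{j+1}$ is allowed), so that the surrogate reflection coefficient $R$ defined in the context is periodic with period $\pi/\Delta_0$. Let $\Omega=(\omega_{\min},\omega_{\max})$ be a finite interval that includes a full period $\pi/\Delta_0$ of $R$, and let $d(\omega)=u(x_\ast,\omega)$, $\omega\in\Omega$, be the measured data. Then the reconstruction algorithm described in the context, applied to $d$ with a chosen integer $N\ge1$, is exact: with $p$ the period computed by the algorithm and $s=N\pi/p$, it reconstructs the restriction of $c$ to the interval $(x_0,x_0+S)$, where $S$ is such that the time it takes a pulse to propagate from $x_0$ to $x_0+S$ is $s$. (Thus $N$ must be chosen large enough for $c$ to be properly reconstructed.)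
   Context: Wave speed: $c(x)=c_0\chi_{(-\infty,x_1]}(x)+\bigl(\sum_{j=1}^{n-1}c_j\chi_{(x_j,x_{j+1}]}(x)\bigr)+c_n\chi_{(x_n,\infty)}(x)$ with all $c_j>0$ and $x_0<x_1<\cdots<x_n$. The point $x_0$ is the source location and $x_\ast$, with $x_0<x_\ast<x_1$, is the measurement location; $c_0,x_0,x_\ast$ are known. Solution: $u(x,\omega)$ is the unique $C^1$ solution of the Helmholtz equation $u''+\kappa^2u=-\delta(x-x_0)$, $\kappa=\omega/c$ (primes denote derivatives in $x$), determined by the outgoing radiation condition: there is no right-travelling wave (multiple of $e^{i\kappa x}$) in $(-\infty,x_0)$ and no left-travelling wave (multiple of $e^{-i\kappa x}$) in $(x_n,\infty)$. Surrogate reflection coefficient: $$R(\omega)=-\frac{2ic_0}{\omega}e^{i\frac{\omega}{c_0}(x_\ast-x_0)}u(x_\ast,\omega)-e^{2i\frac{\omega}{c_0}(x_\ast-x_0)}.$$ Reconstruction algorithm. Parameters: $c_0>0$, $x_0<x_\ast$, $\Omega=(\omega_{\min},\omega_{\max})$ with $\omega_{\min}<\omega_{\max}$. Input: $d(\omega)$ for $\omega\in\Omega$. Preliminary step. Set $R(\omega)=-\frac{2ic_0}{\omega}e^{i\frac{\omega}{c_0}(x_\ast-x_0)}d(\omega)-e^{2i\frac{\omega}{c_0}(x_\ast-x_0)}$ for $\omega\in\Omega$, define $$p=\inf\{\,0<y<|\Omega| \;:\; \omega,\omega+y\in\Omega\Rightarrow R(\omega)=R(\omega+y)\,\},$$ where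 $|\Omega|=\omega_{\max}-\omega_{\min}$, and choose an integer $N\ge1$. Step 1. Set $\alpha_j=\frac1p\int_{\omega_{\min}}^{\omega_{\min}+p}R(\omega)e^{-2ij\frac{\pi}{p}\omega}\,d\omega$ for $1\le j\le N$. Step 2. Set $m_0=1$ and, for $j=1,\dots,N$, $m_j=\alpha_jm_0+\alpha_{j-1}m_1+\cdots+\alpha_1m_{j-1}$. Step 3. Set $\nu_0^0=1$ and, for $j=0,\dots,N-1$ (superscripts are indices, not powers), $$\hat r_{j+1}=\frac{\sum_{i=0}^{j}\overline{\nu_i^jm_{i+1}}}{\sum_{i=0}^{j}\nu_i^jm_{j-i}},$$ $$(\nu_0^{j+1},\dots,\nu_{j+1}^{j+1})=(0,\nu_0^j,\dots,\nu_j^j)-\overline{\hat r_{j+1}}\,\bigl(\overline{\nu_j^j},\overline{\nu_{j-1}^j},\dots,\overline{\nu_0^j},0\bigr).$$ Step 4. Set $\hat c_0=c_0$ and, for $1\le j\le N$, $$\hat c_j=c_0\exp\Bigl(2\sum_{i=1}^j\tanh^{-1}\hat r_i\Bigr),\qquad \hat x_j=x_0+\frac{\pi}{p}\sum_{i=1}^j\hat c_{i-1}.$$ Output (the reconstructed wave speed): $\hat c_0\chi_{(-\infty,\hat x_1]}(x)+\bigl(\sum_{j=1}^{N-1}\hat c_j\chi_{(\hat x_j,\hat x_{j+1}]}(x)\bigr)+\hat c_N\chi_{(\hat x_N,\infty)}(x)$.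
   Formalization: The factor 2ic_0/ω in R (and in the preliminary step) is corrected to 2iω/c_0, since with the printed factor R is not periodic; ω=0, where no outgoing solution exists, is left out; for constant c (where p=0) the claim is empty. *)

(* Defs.v *)
From HB Require Import structures.
From mathcomp Require Import all_boot all_order all_algebra.
From mathcomp Require Import all_classical all_reals all_analysis.
From mathcomp Require Import complex.
Set Implicit Arguments.
Unset Strict Implicit.
Unset Printing Implicit Defensive.
Import Order.TTheory GRing.Theory Num.Theory.
Import numFieldNormedType.Exports.
Local Open Scope classical_set_scope.
Local Open Scope ring_scope.
Local Open Scope complex_scope.

(* R[i] carries no topology or measure here: limits, derivatives and integrals *)
(* of complex-valued functions of a real variable are taken componentwise.     *)

(* e^{i t} *)
Definition cis (R : realType) (t : R) : R[i] := cos t +i* sin t.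

Definition Ccvg (R : realType) (F : set_system R) (f : R -> R[i]) (l : R[i]) :
    Prop :=
  ((fun t => complex.Re (f t)) @ F --> complex.Re l) /\
  ((fun t => complex.Im (f t)) @ F --> complex.Im l).

Definition Cis_derive (R : realType) (f : R -> R[i]) (t : R) (l : R[i]) : Prop :=
  is_derive t (1 : R) (fun s => complex.Re (f s)) (complex.Re l) /\
  is_derive t (1 : R) (fun s => complex.Im (f s)) (complex.Im l).

Definition Cintegral (R : realType) (D : set R) (f : R -> R[i]) : R[i] :=
  (\int[@lebesgue_measure R]_(t in D) complex.Re (f t)) +i*
  (\int[@lebesgue_measure R]_(t in D) complex.Im (f t)).

Definition artanh (R : realType) (r : R) : R := ln ((1 + r) / (1 - r)) / 2.

(* The piecewise constant function with jump points x 1, ..., x n and values   *)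
(* c 0, ..., c n (for n >= 1).                                                 *)
Definition step_speed (R : realType) (n : nat) (c x : nat -> R) (t : R) : R :=
  c 0%N * \1_(`]-oo, x 1%N]%classic) t
  + \sum_(1 <= j < n) c j * \1_(`]x j, x j.+1]%classic) t
  + c n * \1_(`]x n, +oo[%classic) t.

(* u is the outgoing C^1 solution of u'' + kappa^2 u = - delta(. - x 0) with   *)
(* kappa = w / step_speed n c x.  The source makes u continuous everywhere and *)
(* C^1 off x 0, where u' jumps by -1; u'' is discontinuous at the other        *)
(* interfaces x j, where only the C^1 matching is imposed.                     *)
(* There is no such u for w = 0: both outgoing waves are then constant.        *)
Definition outgoing_solution (R : realType) (n : nat) (c x : nat -> R) (w : R)
    (u : R -> R[i]) : Prop :=
  (forall t, Ccvg (nbhs t) u (u t)) /\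
  (exists u' : R -> R[i],
    [/\ forall t, t != x 0%N ->
          Cis_derive u t (u' t) /\ Ccvg (nbhs t) u' (u' t),
        forall t, (forall j, (j <= n)%N -> t != x j) ->
          Cis_derive u' t (- ((w / step_speed n c x t) ^+ 2)%:C * u t)
      & exists l : R[i],
          Ccvg ((x 0%N)^'-) u' l /\ Ccvg ((x 0%N)^'+) u' (l - 1)]) /\
  (exists B : R[i], forall t, t < x 0%N -> u t = B * cis (- (w / c 0%N * t))) /\
  (exists A : R[i], forall t, x n < t -> u t = A * cis (w / c n * t)).

(* Travel time of a pulse from a to b at speed v. *)
Definition travel_time (R : realType) (v : R -> R) (a b : R) : R :=
  \int[@lebesgue_measure R]_(t in `]a, b[%classic) (v t)^-1.

(* Surrogate reflection coefficient computed from d(w) = u(xs, w).  On         *)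
(* (x0, x1) the outgoing solution is                                           *)
(*   i / (2 kappa0) (e^{i kappa0 (t - x0)} + R e^{- i kappa0 (t - x0)}),       *)
(* with kappa0 = w / c0, so the factor in front of d is - 2 i w / c0, the      *)
(* reciprocal of i / (2 kappa0).                                               *)
Definition surrogate (R : realType) (c0 x0 xs : R) (d : R -> R[i]) (w : R) :
    R[i] :=
  - (2 * 'i * (w / c0)%:C) * cis (w / c0 * (xs - x0)) * d w
  - cis (2 * (w / c0) * (xs - x0)).

(* The frequency w = 0, at which there is no datum, takes no part in the       *)
(* comparison.                                                                 *)
Definition alg_period (R : realType) (wmin wmax : R) (rho : R -> R[i]) : R :=
  inf [set y | 0 < y < wmax - wmin /\
    forall w, wmin < w < wmax -> wmin < w + y < wmax ->
      w != 0 -> w + y != 0 -> rho w = rho (w + y)].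

Definition alg_alpha (R : realType) (wmin p : R) (rho : R -> R[i]) (j : nat) :
    R[i] :=
  (p^-1)%:C * Cintegral `]wmin, (wmin + p)[%classic
    (fun w => rho w * cis (- (2 * j%:R * (pi / p) * w))).

(* [:: m_0; ...; m_j] *)
Fixpoint alg_moments (R : realType) (alpha : nat -> R[i]) (j : nat) : seq R[i] :=
  if j is k.+1 then
    let s := alg_moments alpha k in
    rcons s (\sum_(i < k.+1) alpha (k.+1 - i)%N * s`_i)
  else [:: 1].

Definition alg_moment (R : realType) (alpha : nat -> R[i]) (j : nat) : R[i] :=
  (alg_moments alpha j)`_j.

Definition rhat_den (R : realType) (m v : nat -> R[i]) (j : nat) : R[i] :=
  \sum_(i < j.+1) v i * m (j - i)%N.

Definition rhat_next (R : realType) (m v : nat -> R[i]) (j : nat) : R[i] :=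
  (\sum_(i < j.+1) (v i * m i.+1)^*) / rhat_den m v j.

(* alg_nu m j i is nu_i^j, extended by 0 to i > j. *)
Fixpoint alg_nu (R : realType) (m : nat -> R[i]) (j : nat) : nat -> R[i] :=
  if j is k.+1 then
    let v := alg_nu m k in
    fun i => (if i is l.+1 then v l else 0)
             - (rhat_next m v k)^* * (if (i <= k)%N then (v (k - i)%N)^* else 0)
  else fun i => (i == 0%N)%:R.

(* Meaningful for j >= 1. *)
Definition alg_rhat (R : realType) (m : nat -> R[i]) (j : nat) : R[i] :=
  rhat_next m (alg_nu m j.-1) j.-1.

(* For real r i the real part is a mere cast to R.                              *)
Definition alg_chat (R : realType) (c0 : R) (r : nat -> R[i]) (j : nat) : R :=
  c0 * expR (2 * \sum_(1 <= i < j.+1) artanh (complex.Re (r i))).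

Definition alg_xhat (R : realType) (x0 p : R) (chat : nat -> R) (j : nat) : R :=
  x0 + pi / p * \sum_(1 <= i < j.+1) chat i.-1.

(* The whole algorithm: the reconstructed wave speed. *)
Definition reconstruction (R : realType) (c0 x0 xs wmin wmax : R) (N : nat)
    (d : R -> R[i]) : R -> R :=
  let rho := surrogate c0 x0 xs d in
  let p := alg_period wmin wmax rho in
  let m := alg_moment (alg_alpha wmin p rho) in
  let chat := alg_chat c0 (alg_rhat m) in
  step_speed N chat (alg_xhat x0 p chat).

(* Main.v *)
Require Import Defs.
From mathcomp Require Import all_boot all_order all_algebra.
From mathcomp Require Import all_classical all_reals all_analysis.
From mathcomp Require Import complex.
From mathcomp Require Import measurable_realfun ring lra zify.
Set Implicit Arguments.
Unset Strict Implicit.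
Unset Printing Implicit Defensive.
Import Order.TTheory GRing.Theory Num.Theory.
Import numFieldNormedType.Exports.
Local Open Scope classical_set_scope.
Local Open Scope ring_scope.
Local Open Scope complex_scope.

(* In each layer u is a pair of plane waves, and matching u and u' across an
   interface acts on the quotient (left-moving)/(right-moving) amplitude by
   g |-> z (r + g) / (1 + r g), where z = e^{2 i Delta0 w} and r is the
   reflection coefficient of the interface.  Starting from g = 0 to the right
   of x n, the surrogate reflection coefficient is therefore P(z)/Q(z) with real
   polynomials P and Q, and its Schur parameters are the r's: hence periodicity.
   A rotation zeta leaves P/Q invariant iff zeta^(i+1) = 1 whenever r_i <> 0, so
   the smallest period is pi/(k Delta0), where k is the gcd of the indices of
   the genuine interfaces, and P/Q depends only on z^k.
   Since |P| < |Q| on the unit circle, 1/Q is there a uniform limit of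
   polynomials, and the Fourier coefficients of P/Q are its Taylor coefficients.
   The m_j are then the coefficients of 1/(1 - P/Q), Step 3 is Szego's recursion,
   and Geronimus' theorem says that it returns the Schur parameters. *)

(** No power series are used. Those of P/Q and 1/(1 - P/Q) occur as polynomials [A] and [M] known
    modulo ['X^(N.+1)], which is all that N steps of the algorithm can see. Geronimus' theorem then
    becomes polynomial algebra: one product of layer matrices is read from the far end
    ([schur_pair]) and from the source ([wall]). 1/Q cannot be expanded in a single geometric
    series, since Q - 1 need not be small on the circle. The recursion factors it: adding an
    interface multiplies Q by 1 + r P/Q, where |r P/Q| <= |r| < 1. The algorithm sees p but not
    Delta0, so it works with coarser layers, of travel time k Delta0. These still resolve the
    medium, since no genuine interface falls inside one of them. A homogeneous medium stands apart:
    the set defining p is then all of (0, |Omega|), so p is 0, and with the convention 1/0 = 0 the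
    claim holds with S = 0. The frequency 0 carries no datum, hence the exceptional points in the
    integrals and in the root count. *)

(** * Schur parameters *)

Section SchurPair.
Variable F : comNzRingType.
Implicit Types (s : nat -> F) (m : nat).

(** Numerator and denominator of the composed maps g |-> X (s_i + g) / (1 + s_i g), applied to g =
    0; [s 0] is the outermost map, that is, the interface nearest to the source. Keeping a pair
    avoids division. *)
Fixpoint schur_pair s m : {poly F} * {poly F} :=
  if m is m'.+1 then
    let PQ := schur_pair (fun i => s i.+1) m' in
    ('X * (PQ.1 + (s 0%N)%:P * PQ.2), PQ.2 + (s 0%N)%:P * PQ.1)
  else (0, 1).

Definition schur_num s m := (schur_pair s m).1.
Definition schur_den s m := (schur_pair s m).2.

Lemma schur_numS s m : schur_num s m.+1 =
  'X * (schur_num (fun i => s i.+1) m + (s 0%N)%:P * schur_den (fun i => s i.+1) m).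
Proof. by []. Qed.

Lemma schur_denS s m : schur_den s m.+1 =
  schur_den (fun i => s i.+1) m + (s 0%N)%:P * schur_num (fun i => s i.+1) m.
Proof. by []. Qed.

Lemma schur_num0 s m : (schur_num s m)`_0 = 0.
Proof. by case: m => [|m]; rewrite ?schur_numS ?coefXM //= coef0. Qed.

Lemma schur_den0 s m : (schur_den s m)`_0 = 1.
Proof.
elim: m s => [|m IH] s; first by rewrite /schur_den /= coef1.
by rewrite schur_denS coefD coefCM schur_num0 mulr0 addr0 IH.
Qed.

Lemma eq_schur_pair s t m : (forall i, (i < m)%N -> s i = t i) ->
  schur_pair s m = schur_pair t m.
Proof.
elim: m s t => [//|m IH] s t st /=.
by rewrite (IH _ (fun i => t i.+1)) ?st // => i im; apply: st.
Qed.

(** A layer of parameter 0 fixes the pair (0, 1), which stands for nothing coming back. This pads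
    finitely many interfaces to any length. *)
Lemma schur_pair_trailing s m l : (forall i, (m <= i)%N -> s i = 0) ->
  schur_pair s (m + l) = schur_pair s m.
Proof.
elim: m s => [|m IH] s s0; last by rewrite addSn /= IH // => i mi; apply: s0.
rewrite add0n; elim: l s s0 => [//|l IH] s s0 /=.
by rewrite IH ?s0 //= ?mul0r ?addr0 ?mulr0 // => i _; apply: s0.
Qed.

(** A layer of parameter 0 only multiplies the quotient by ['X], the round-trip phase. *)
Lemma schur_pair_leading s k m : (forall i, (i < k)%N -> s i = 0) ->
  schur_pair s (k + m) =
  ('X^k * schur_num (fun i => s (k + i)%N) m, schur_den (fun i => s (k + i)%N) m).
Proof.
elim: k s => [|k IH] s s0; first by rewrite add0n expr0 mul1r -surjective_pairing.
rewrite addSn /= (IH (fun i => s i.+1)) => [|i ik]; last by apply: s0.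
by rewrite s0 //= !mul0r !addr0 exprS mulrA.
Qed.

(** [s i] sits at the interface [x i.+1], so a block of [k] layers has at most one nonzero
    parameter, at its far end, with index [(k * i.+1).-1]. The other layers only multiply by z, so
    the block acts as one layer of phase z^k. *)
Lemma schur_pair_horner_stretch s k m z : (0 < k)%N ->
  (forall i, ~~ (k %| i.+1)%N -> s i = 0) ->
  let s' := fun i => s (k * i.+1).-1 in
  (schur_num s (k * m)).[z] = (schur_num s' m).[z ^+ k] /\
  (schur_den s (k * m)).[z] = (schur_den s' m).[z ^+ k].
Proof.
case: k => // k _; elim: m s => [|m IH] s s0 /=.
  by rewrite muln0 /schur_num /schur_den /= !hornerE.
have s0k i : (i < k)%N -> s i = 0.
  by move=> ik; apply: s0; rewrite gtnNdvd // ltnS.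
have [|IH1 IH2] := IH (fun i => s (k.+1 + i)%N).
  by move=> i ki; apply: s0; rewrite -addnS dvdn_addr.
have e : (k.+1 * m.+1 = k + (k.+1 * m).+1)%N by rewrite mulnS addSn addnS.
have es : schur_pair (fun i => s (k + i.+1)%N) (k.+1 * m) =
          schur_pair (fun i => s (k.+1 + i)%N) (k.+1 * m).
  by apply: eq_schur_pair => i _; rewrite addnS addSn.
have es' : schur_pair (fun i => s (k.+1 * i.+2).-1) m =
           schur_pair (fun i => s (k.+1 + (k.+1 * i.+1).-1)%N) m.
  by apply: eq_schur_pair => i _; rewrite !mulnS !addSn /= addnS.
rewrite e /schur_num /schur_den !schur_pair_leading //= /schur_num /schur_den /=.
move: IH1 IH2; rewrite /schur_num /schur_den addn0 muln1 es es' /= => IH1 IH2.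
rewrite !hornerE IH1 IH2 exprS; split => //; by rewrite -[LHS]/(z ^+ k * z * _) (mulrC (z ^+ k)).
Qed.

End SchurPair.

Lemma map_schur_pair (F G : comNzRingType) (f : {rmorphism F -> G}) (s : nat -> F) m :
  map_poly f (schur_num s m) = schur_num (f \o s) m /\
  map_poly f (schur_den s m) = schur_den (f \o s) m.
Proof.
elim: m s => [|m IH] s.
  by rewrite /schur_num /schur_den /= rmorph0 rmorph1.
have [IH1 IH2] := IH (fun i => s i.+1).
by rewrite !schur_numS !schur_denS !(rmorphM, rmorphD) /= !map_polyC map_polyX /= IH1 IH2.
Qed.

(** * Rotations that fix a Schur quotient *)

Section Rotation.
Variable F : fieldType.

(** The factor [eta] collects the powers of [zeta] that the induction peels off. After cancelling
    ['X], the constant coefficients give [eta * zeta * a = a] for the first parameter a. If a = 0,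
    the tail satisfies the same identity with [eta * zeta]. Otherwise [eta * zeta = 1], and the
    difference of the two sides is 1 - a^2 times that of the tail, hence the hypothesis on
    squares. *)
Lemma schur_rotate (s : nat -> F) m (eta zeta : F) :
  (forall i, s i ^+ 2 != 1) ->
  eta *: ((schur_num s m \Po (zeta *: 'X)) * schur_den s m) =
    schur_num s m * (schur_den s m \Po (zeta *: 'X)) <->
  (forall i, (i < m)%N -> s i != 0 -> eta * zeta ^+ i.+1 = 1).
Proof.
elim: m s eta => [|m IH] s eta s1.
  by split => // _; rewrite /schur_num /= comp_poly0 !mul0r scaler0.
have := IH (fun i => s i.+1) (eta * zeta) (fun i => s1 i.+1).
rewrite schur_numS schur_denS.
have P0 := schur_num0 (fun i => s i.+1) m; have Q0 := schur_den0 (fun i => s i.+1) m.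
move: (schur_num _ m) (schur_den _ m) P0 Q0 => P Q P0 Q0 IHm.
set a := s 0%N.
rewrite comp_polyM comp_polyX !comp_polyD !comp_polyM !comp_polyC.
set P' := (P \Po (zeta *: 'X)) in IHm *; set Q' := (Q \Po (zeta *: 'X)) in IHm *.
have P'0 : P'`_0 = 0.
  rewrite /P' -horner_coef0 horner_comp !hornerE ?mulr0 ?horner_coef0 //.
have Q'0 : Q'`_0 = 1.
  by rewrite /Q' -horner_coef0 horner_comp !hornerE ?mulr0 ?horner_coef0.
have step : (eta *: ((zeta *: 'X) * (P' + a%:P * Q') * (Q + a%:P * P)) =
    'X * (P + a%:P * Q) * (Q' + a%:P * P')) <->
   (eta * zeta) *: ((P' + a%:P * Q') * (Q + a%:P * P)) =
    (P + a%:P * Q) * (Q' + a%:P * P').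
  rewrite -!scalerAl scalerA -mulrA (scalerAr _ 'X) -(mulrA 'X); split => [|-> //].
  by apply: mulfI; rewrite polyX_eq0.
have at0 : (eta * zeta) *: ((P' + a%:P * Q') * (Q + a%:P * P)) =
    (P + a%:P * Q) * (Q' + a%:P * P') -> eta * zeta * a = a.
  move/(congr1 (fun p : {poly F} => p`_0)).
  by rewrite coefZ !coef0M !(coefD, coefCM) P0 Q0 P'0 Q'0 !mulr0 !add0r !mulr1 addr0 mulr1.
apply: (iff_trans step).
have [a0|a0] := eqVneq a 0.
  rewrite a0 !mul0r !addr0.
  apply: (iff_trans IHm); split=> H.
    by case=> [|i] im; [by rewrite -/a a0 eqxx | move=> ?; rewrite exprS mulrA H].
  by move=> i im si; rewrite -mulrA -exprS H.
have eqv : eta * zeta = 1 -> ((eta * zeta) *: ((P' + a%:P * Q') * (Q + a%:P * P)) =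
    (P + a%:P * Q) * (Q' + a%:P * P') <-> (eta * zeta) *: (P' * Q) = P * Q').
  move=> ->; rewrite !scale1r.
  have u : (1 - a ^+ 2)%:P != 0 :> {poly F}.
    by rewrite polyC_eq0 subr_eq0 eq_sym s1.
  have e : (P' + a%:P * Q') * (Q + a%:P * P) - (P + a%:P * Q) * (Q' + a%:P * P') =
           (1 - a ^+ 2)%:P * (P' * Q - P * Q').
    rewrite polyCB polyC_exp /=; ring.
  split=> H; last by apply/eqP; rewrite -subr_eq0 e H subrr mulr0.
  by apply/eqP; rewrite -subr_eq0 -(mulrI_eq0 _ (mulfI u)) -e H subrr.
split=> [H|H].
  have ez : eta * zeta = 1 by apply: (mulIf a0); rewrite mul1r at0.
  case=> [|i] im si; first by rewrite expr1.
  rewrite exprS mulrA; move/eqv: H => /(_ ez)/IHm; exact.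
have ez : eta * zeta = 1 by rewrite -[zeta]expr1; apply: H.
apply/eqv => //; apply/IHm => i im si; by rewrite -mulrA -exprS H.
Qed.
End Rotation.

(** * Geronimus' theorem *)

Section Geronimus.
Variables (F : fieldType) (s : nat -> F).

(** The row (u0, 1) multiplied from the right by the layer matrices [X, s_k X; s_k, 1], which
    [schur_pair] applies to columns. The start 0 leads to Q and the start -1 to Q - P, the two
    polynomials of 1/(1 - P/Q). *)
Fixpoint wall (u0 : F) j : {poly F} * {poly F} :=
  if j is k.+1 then
    let: (u, v) := wall u0 k in
    ('X * u + (s k)%:P * v, v + (s k)%:P * ('X * u))
  else (u0%:P, 1).

Lemma wallS u0 j : wall u0 j.+1 =
  ('X * (wall u0 j).1 + (s j)%:P * (wall u0 j).2,
   (wall u0 j).2 + (s j)%:P * ('X * (wall u0 j).1)).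
Proof. by rewrite /=; case: (wall u0 j). Qed.

(** Associativity of the matrix product: the row after [j] layers paired with the remaining column
    does not depend on [j]. *)
Lemma wall_schur u0 L j : (j <= L)%N ->
  (wall u0 j).2 * schur_den (fun i => s (j + i)%N) (L - j) +
  (wall u0 j).1 * schur_num (fun i => s (j + i)%N) (L - j) =
  schur_den s L + u0%:P * schur_num s L.
Proof.
elim: j => [|j IH] jL; first by rewrite subn0 /= mul1r.
rewrite -(IH (ltnW jL)) -(subnSK jL) schur_numS schur_denS wallS /= addn0.
have E : schur_pair (fun i => s (j + i.+1)%N) (L - j.+1) =
         schur_pair (fun i => s (j.+1 + i)%N) (L - j.+1).
  by apply: eq_schur_pair => i _; rewrite addnS.
rewrite /schur_num /schur_den E; ring.
Qed.

Definition wall_det j := \prod_(i < j) (1 - s i ^+ 2).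

(** Each layer matrix has determinant X (1 - s_k^2), and the two starting rows have determinant
    1. *)
Lemma wall_detE j :
  (wall 0 j).1 * (wall (-1) j).2 - (wall 0 j).2 * (wall (-1) j).1 =
  wall_det j *: 'X^j.
Proof.
elim: j => [|j IH].
  by rewrite /wall_det big_ord0 scale1r expr0 /= polyCN mul0r; ring.
have -> : wall_det j.+1 = (1 - s j ^+ 2) * wall_det j.
  by rewrite /wall_det big_ord_recr mulrC.
rewrite -scalerA (exprS 'X) scalerAr -IH -mul_polyC polyCB polyC_exp !wallS /=; ring.
Qed.

Lemma wall_coef_gt u0 j i : (j < i)%N -> (wall u0 j).1`_i = 0 /\ (wall u0 j).2`_i = 0.
Proof.
elim: j i => [|j IH] [//|i] ji.
  by rewrite /= coefC coef1 /=.
rewrite wallS /= !(coefD, coefCM, coefXM) /=.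
have [-> _] := IH i ji; have [_ ->] := IH i.+1 (ltnW ji).
by rewrite !mulr0 addr0.
Qed.

(* The start value [-1] makes the two components reversals of each other up to sign *)
Lemma wall_rev j i : (i <= j)%N ->
  (wall (-1) j).2`_i = - (wall (-1) j).1`_(j - i).
Proof.
elim: j i => [|j IH] i ij.
  by move: ij; rewrite leqn0 => /eqP ->; rewrite -[LHS]/((1 : {poly F})`_0) -[RHS]/(- ((-1)%:P : {poly F})`_0) coef1 coefC opprK.
rewrite wallS /= !(coefD, coefCM, coefXM).
case: i ij => [|i] ij /=.
  have [_ g] := wall_coef_gt (-1) (ltnSn j).
  by rewrite IH // g !subn0 !mulr0 !addr0.
rewrite subSS; have [ji|ji] := ltnP i j.
  rewrite subn_eq0 leqNgt ji /= IH // subnS IH ?leq_subr // subKn ?(ltnW ji) //; ring.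
have -> : i = j by apply/eqP; rewrite eqn_leq ji andbT.
have [_ ->] := wall_coef_gt (-1) (ltnSn j).
by rewrite subnn eqxx !add0r IH // subn0 mulrN opprK.
Qed.

Lemma wall_first_coef j : (wall 0 j).1`_j = 0 /\ (wall 0 j).2`_j.+1 = 0.
Proof.
split; last by have [] := wall_coef_gt 0 (ltnSn j).
elim: j => [|j IH]; first by rewrite /= coefC.
rewrite wallS /= coefD coefCM coefXM /= IH.
by have [_ ->] := wall_coef_gt 0 (ltnSn j); rewrite mulr0 addr0.
Qed.

Lemma coprimep_Xn (E : {poly F}) n : E`_0 != 0 -> coprimep 'X^n E.
Proof.
move=> E0; apply: coprimep_expl; rewrite coprimep_sym.
by rewrite -['X]subr0 -polyC0 coprimep_XsubC rootE horner_coef0.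
Qed.

Lemma dvd_Xn_coef (p : {poly F}) n i : 'X^n %| p -> (i < n)%N -> p`_i = 0.
Proof. by move=> /dvdpP [q ->] ni; rewrite coefMXn ni. Qed.

(** [E] is a unit modulo powers of ['X], so that [Y] agrees with ['X^j * Z / E] up to order j. *)
Lemma coef_Xn_cancel (Y E Z : {poly F}) j : E`_0 = 1 ->
  'X^(j.+1) %| Y * E - 'X^j * Z -> Y`_j = Z`_0.
Proof.
move=> E0 dv.
have : 'X^j %| Y.
  rewrite -(@Gauss_dvdpl _ _ E) ?coprimep_Xn ?E0 ?oner_eq0 //.
  rewrite -[Y * E](subrK ('X^j * Z)) dvdp_add ?dvdp_mulr //.
  by apply: dvdp_trans dv; apply: dvdp_exp2l.
case/dvdpP => Y' YE; rewrite YE coefMXn ltnn subnn.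
move: dv; rewrite YE (_ : Y' * 'X^j * E - _ = 'X^j * (Y' * E - Z)); last by ring.
rewrite exprSr dvdp_mul2l ?expf_neq0 ?polyX_eq0 // => X1; have := dvd_Xn_coef (n := 1) X1 (ltnSn 0).
by rewrite coefB coef0M E0 mulr1 => /eqP; rewrite subr_eq0 => /eqP.
Qed.

Variables (L N : nat) (A M : {poly F}).
Hypothesis NL : (N <= L)%N.
Hypothesis hA : 'X^(N.+1) %| A * schur_den s L - schur_num s L.
Hypothesis hM : 'X^(N.+1) %| M * (1 - A) - 1.

Let P := schur_num s L.
Let Q := schur_den s L.

Let hMQ : 'X^(N.+1) %| M * (Q - P) - Q.
Proof.
have -> : M * (Q - P) - Q = (M * (1 - A) - 1) * Q + M * (A * Q - P) by ring.
by apply: dvdp_add; [apply: dvdp_mulr | apply: dvdp_mull].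
Qed.

(** With (c, d) and (u, w) the rows started at 0 and -1, Cramer's rule in [wall_schur] gives c (Q -
    P) - u Q = D Qj and w Q - d (Q - P) = D Pj, where D = [wall_det j *: 'X^j]. Dividing by Q - P
    turns Q into M. The degrees of c and d are too small to reach the coefficients read, and [s j]
    appears because Pj is X times a polynomial with constant coefficient [s j]. *)
Lemma geronimus j : (j < N)%N ->
  (M * (- (wall (-1) j).1))`_j = wall_det j /\
  (M * (wall (-1) j).2)`_j.+1 = wall_det j * s j.
Proof.
move=> jN; have jL : (j < L)%N := leq_trans jN NL.
set c := (wall 0 j).1; set d := (wall 0 j).2.
set u := (wall (-1) j).1; set w := (wall (-1) j).2.
set Pj := schur_num (fun i => s (j + i)%N) (L - j).
set Qj := schur_den (fun i => s (j + i)%N) (L - j).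
have e1 : w * Qj + u * Pj = Q - P by rewrite wall_schur ?(ltnW jL) // polyCN mulN1r.
have e0 : d * Qj + c * Pj = Q by rewrite wall_schur ?(ltnW jL) // polyC0 mul0r addr0.
have det : c * w - d * u = wall_det j *: 'X^j by apply: wall_detE.
have E0 : (Q - P)`_0 = 1 by rewrite coefB schur_den0 schur_num0 subr0.
have cj := wall_first_coef j.
have le k : (k <= N.+1)%N -> 'X^k %| M * (Q - P) - Q.
  by move=> kN; apply: dvdp_trans hMQ; apply: dvdp_exp2l.
split.
  have : (M * - u + c)`_j = (wall_det j *: Qj)`_0.
    apply: (@coef_Xn_cancel _ (Q - P)) => //.
    have -> : (M * - u + c) * (Q - P) - 'X^j * (wall_det j *: Qj) =
              - u * (M * (Q - P) - Q).
      rewrite -scalerAr scalerAl -det.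
      transitivity (- u * (M * (Q - P)) + c * (Q - P) - (c * w - d * u) * Qj); first by ring.
      transitivity (- u * (M * (Q - P)) + u * (d * Qj + c * Pj)); last by rewrite e0; ring.
      by rewrite -[in c * _]e1; ring.
    by apply: dvdp_mull; apply: le; rewrite ltnS ltnW.
  by rewrite coefD (proj1 cj) addr0 coefZ schur_den0 mulr1.
have : (M * w - d)`_j.+1 = (wall_det j *: (schur_num (fun i => s (j + i.+1)%N) (L - j.+1)
     + (s j)%:P * schur_den (fun i => s (j + i.+1)%N) (L - j.+1)))`_0.
  apply: (@coef_Xn_cancel _ (Q - P)) => //.
  set Z := (schur_num _ _ + _ * _).
  have eZ : Pj = 'X * Z by rewrite /Pj -(subnSK jL) schur_numS addn0.
  have -> : (M * w - d) * (Q - P) - 'X^(j.+1) * (wall_det j *: Z) = w * (M * (Q - P) - Q).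
    rewrite -scalerAr exprSr -mulrA -eZ scalerAl -det.
    transitivity (w * (M * (Q - P)) - d * (Q - P) - (c * w - d * u) * Pj); first by ring.
    transitivity (w * (M * (Q - P)) - w * (d * Qj + c * Pj)); last by rewrite e0; ring.
    by rewrite -[in d * _]e1; ring.
  by apply: dvdp_mull; apply: le.
rewrite coefB (proj2 cj) subr0 => ->.
by rewrite coefZ coefD coefCM schur_num0 schur_den0 add0r mulr1.
Qed.

End Geronimus.

(** Bezout for ['X^N] and [Q], coprime as Q does not vanish at 0, inverts [Q] modulo ['X^N]; [A] is
    the Taylor polynomial of P/Q. *)
Lemma truncated_quotient (F : fieldType) (P Q : {poly F}) N :
  Q`_0 != 0 -> exists2 A : {poly F}, (size A <= N)%N & 'X^N %| A * Q - P.
Proof.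
move=> Q0; have /Bezout_eq1_coprimepP [[a b] /= e] := coprimep_Xn N Q0.
exists ((P * b) %% 'X^N).
  by rewrite -ltnS -(size_polyXn F N) ltn_modp -size_poly_gt0 size_polyXn.
have -> : (P * b) %% 'X^N * Q - P =
   - ((P * b) %/ 'X^N * 'X^N * Q) + P * (a * 'X^N + b * Q - 1) - P * a * 'X^N.
  set q := _ %/ _; set r := _ %% _.
  have eb : P * b = q * 'X^N + r by apply: divp_eq.
  transitivity ((P * b - q * 'X^N) * Q - P); first by rewrite eb addrAC subrr add0r.
  ring.
rewrite e subrr mulr0 addr0; apply: dvdp_sub; last by rewrite dvdp_mull.
by rewrite dvdpNr mulrAC dvdp_mull.
Qed.

(** * The reconstruction algorithm *)

Lemma conj_real_complex (R : realType) (x : R) : Num.conj (x%:C : R[i]) = x%:C.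
Proof. by apply: conj_Creal; rewrite complex_real. Qed.

Section Algorithm.
Variable R : realType.

Lemma size_alg_moments (alpha : nat -> R[i]) j : size (alg_moments alpha j) = j.+1.
Proof. by elim: j => [//|j IH]; rewrite /= size_rcons IH. Qed.

Lemma nth_alg_moments (alpha : nat -> R[i]) j i : (i <= j)%N ->
  (alg_moments alpha j)`_i = alg_moment alpha i.
Proof.
elim: j => [|j IH] ij; first by move: ij; rewrite leqn0 => /eqP ->.
move: ij; rewrite leq_eqVlt => /predU1P[-> //|ij].
by rewrite /= nth_rcons size_alg_moments ij IH.
Qed.

Lemma alg_momentS (alpha : nat -> R[i]) j :
  alg_moment alpha j.+1 =
  \sum_(i < j.+1) alpha (j.+1 - i)%N * alg_moment alpha i.
Proof.
rewrite /alg_moment /= nth_rcons size_alg_moments ltnn eqxx.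
by apply: eq_bigr => i _; rewrite nth_alg_moments // -ltnS.
Qed.

Variables (alpha : nat -> R[i]) (s : nat -> R) (L N : nat) (A : {poly R}).
Hypothesis s1 : forall i, `|s i| < 1.
Hypothesis NL : (N <= L)%N.
Hypothesis A0 : A`_0 = 0.
Hypothesis hA : 'X^(N.+1) %| A * schur_den s L - schur_num s L.
Hypothesis alphaE : forall j, (1 <= j <= N)%N -> alpha j = (A`_j)%:C.

Let m := alg_moment alpha.

Lemma wall_det_gt0 j : 0 < wall_det s j.
Proof. by apply: prodr_gt0 => i _; rewrite subr_gt0 -real_normK ?num_real // expr_lt1. Qed.

(** Step 2 is the equation M = 1 + M A read coefficient by coefficient. *)
Lemma alg_moment_inverse : exists2 M : {poly R}, 'X^(N.+1) %| M * (1 - A) - 1 &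
  forall j, (j <= N)%N -> m j = (M`_j)%:C.
Proof.
have [M _ hM] : exists2 M : {poly R}, (size M <= N.+1)%N & 'X^(N.+1) %| M * (1 - A) - 1.
  by apply: truncated_quotient; rewrite coefB coef1 A0 subr0 oner_eq0.
exists M => //; have cf j : (j <= N)%N -> M`_j = (M * A)`_j + (j == 0%N)%:R.
  move=> jN; have := dvd_Xn_coef hM jN.
  by rewrite mulrBr mulr1 !coefB coef1 => /eqP; rewrite subr_eq0 subr_eq addrC => /eqP.
elim/ltn_ind => -[|j] IH jN; first by rewrite cf // coef0M A0 mulr0 add0r.
rewrite /m alg_momentS cf // addr0 coefM [in RHS]big_ord_recr /= subnn A0 mulr0 addr0.
rewrite rmorph_sum; apply: eq_bigr => i _ /=.
have iN : (i <= N)%N by rewrite (leq_trans _ jN) // ltnW.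
rewrite -/(m i) IH // alphaE; last by rewrite subn_gt0 ltn_ord /= (leq_trans _ jN) // leq_subr.
by rewrite rmorphM mulrC.
Qed.

(** The vector nu^j is minus the first component of the row started at -1. As everything is real,
    its reversed conjugate is the second component by [wall_rev], and Step 3 becomes the recursion
    of [wall]. The denominators are products of 1 - s_i^2, hence nonzero. *)
Lemma alg_nu_rhat j : (j < N)%N ->
  [/\ forall i, alg_nu m j i = (- (wall s (-1) j).1`_i)%:C,
      rhat_den m (alg_nu m j) j = (wall_det s j)%:C &
      rhat_next m (alg_nu m j) j = (s j)%:C].
Proof.
have [M hM mE] := alg_moment_inverse.
have step k : (k < N)%N -> (forall i, alg_nu m k i = (- (wall s (-1) k).1`_i)%:C) ->
   rhat_den m (alg_nu m k) k = (wall_det s k)%:C /\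
   rhat_next m (alg_nu m k) k = (s k)%:C.
  move=> kN nuE; have [g1 g2] := geronimus NL hA hM kN.
  have den : rhat_den m (alg_nu m k) k = (wall_det s k)%:C.
    rewrite -g1 mulrC coefM rmorph_sum; apply: eq_bigr => i _ /=.
    by rewrite nuE mE ?coefN ?rmorphM // (leq_trans (leq_subr _ _)) // ltnW.
  split=> //; rewrite /rhat_next den.
  have -> : \sum_(i < k.+1) Num.conj (alg_nu m k i * m i.+1) = (wall_det s k * s k)%:C.
    rewrite -g2 (mulrC M) coefM [in RHS]big_ord_recr /= (proj2 (wall_coef_gt _ _ (ltnSn k))).
    (* The numerator of Step 3 is a correlation; reversing the index turns it into the convolution
       with the reversed polynomial that [geronimus] evaluates. *)
    rewrite mul0r addr0 rmorph_sum /= (reindex_inj rev_ord_inj); apply: eq_bigr => i _ /=.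
    rewrite subSS nuE mE; last by lia.
    have ik : (i <= k)%N by rewrite -ltnS.
    by rewrite -rmorphM conj_real_complex wall_rev // subSn.
  by rewrite rmorphM mulrC mulKf // fmorph_eq0 gt_eqF // wall_det_gt0.
elim: j => [|j IH] jN.
  have nu0 i : alg_nu m 0 i = (- (wall s (-1) 0).1`_i)%:C.
    by rewrite /= coefC; case: i => [|i] /=; rewrite ?opprK ?oppr0 ?rmorph1 ?rmorph0.
  by have [] := step 0%N jN nu0; split.
have [nuE _ rE] := IH (ltnW jN).
have nuS i : alg_nu m j.+1 i = (- (wall s (-1) j.+1).1`_i)%:C.
  rewrite [LHS]/= -/(alg_nu m j) rE conj_real_complex wallS /= coefD coefCM coefXM.
  have -> : (if i is l.+1 then alg_nu m j l else 0) =
     (- (if i == 0%N then 0 else (wall s (-1) j).1`_i.-1))%:C.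
    by case: i => [|i] /=; rewrite ?oppr0 ?rmorph0 // nuE.
  have -> : (if (i <= j)%N then Num.conj (alg_nu m j (j - i)%N) else 0) = ((wall s (-1) j).2`_i)%:C.
    case: leqP => ij; first by rewrite nuE conj_real_complex wall_rev.
    by rewrite (proj2 (wall_coef_gt _ _ ij)) rmorph0.
  by rewrite -rmorphM -rmorphB opprD.
by have [] := step j.+1 jN nuS; split.
Qed.

End Algorithm.

(** * Uniform approximation on the unit circle *)

Section Circle.
Variable R : realType.
Notation C := R[i].
Implicit Types (g h : C -> C) (T : {poly C}).

(** Only nonnegative powers of z are allowed: such a limit, multiplied by z^(N+1), has no Fourier
    mode up to N. *)
Definition poly_approx g := forall e : R, 0 < e ->
  exists T : {poly C}, forall z, `|z| = 1 -> `|g z - T.[z]| <= e%:C.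

Lemma poly_bounded T :
  exists2 B : R, 0 < B & forall z : C, `|z| = 1 -> `|T.[z]| <= B%:C.
Proof.
exists (complex.Re (\sum_(i < size T) `|T`_i|) + 1).
  rewrite ltr_wpDl //.
  have : 0 <= \sum_(i < size T) `|T`_i| by apply: sumr_ge0.
  by rewrite lecE => /andP[].
move=> z z1; rewrite rmorphD /= RRe_real; last by rewrite ger0_real // sumr_ge0.
rewrite ler_wpDr ?ler0c ?ler01 // horner_coef.
apply: le_trans (ler_norm_sum _ _ _) _; apply: ler_sum => i _.
by rewrite normrM normrX z1 expr1n mulr1.
Qed.

Lemma poly_approx_lim g :
  (forall e : R, 0 < e -> exists2 h, poly_approx h &
     forall z, `|z| = 1 -> `|g z - h z| <= e%:C) -> poly_approx g.
Proof.
move=> H e e0; have e2 : 0 < e / 2 by rewrite divr_gt0.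
have [h /(_ _ e2) [T hT] gh] := H _ e2.
exists T => z z1; rewrite [e]splitr rmorphD /=.
apply: le_trans (ler_distD (h z) _ _) _.
by rewrite lerD ?gh ?hT.
Qed.

Lemma poly_approx_poly T : poly_approx (fun z => T.[z]).
Proof. by move=> e e0; exists T => z _; rewrite subrr normr0 ler0c ltW. Qed.

Lemma poly_approxD g h : poly_approx g -> poly_approx h ->
  poly_approx (fun z => g z + h z).
Proof.
move=> hg hh e e0.
have [|T hT] := hg (e / 2); first by rewrite divr_gt0.
have [|S hS] := hh (e / 2); first by rewrite divr_gt0.
exists (T + S) => z z1; rewrite [e]splitr rmorphD /= hornerD opprD addrACA.
by apply: le_trans (ler_normD _ _) _; rewrite lerD ?hT ?hS.
Qed.

Lemma poly_approx_bounded g : poly_approx g ->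
  exists2 B : R, 0 < B & forall z : C, `|z| = 1 -> `|g z| <= B%:C.
Proof.
move=> /(_ 1 ltr01) [T hT]; have [B B0 hB] := poly_bounded T.
exists (1 + B) => [|z z1]; first by rewrite addr_gt0.
rewrite rmorphD /= -[g z](subrK T.[z]).
by apply: le_trans (ler_normD _ _) _; rewrite lerD ?hT ?hB.
Qed.

Lemma poly_approxM g h : poly_approx g -> poly_approx h ->
  poly_approx (fun z => g z * h z).
Proof.
move=> hg hh e e0.
have [B B0 hB] := poly_approx_bounded hg.
have [|S hS] := hh (e / 2 / B); first by rewrite !divr_gt0.
have [D D0 hD] := poly_bounded S.
have [|T hT] := hg (e / 2 / D); first by rewrite !divr_gt0.
exists (T * S) => z z1; rewrite hornerM.
have -> : g z * h z - T.[z] * S.[z] = (h z - S.[z]) * g z + (g z - T.[z]) * S.[z] by ring.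
apply: le_trans (ler_normD _ _) _; rewrite !normrM.
have -> : e%:C = (e / 2 / B)%:C * B%:C + (e / 2 / D)%:C * D%:C :> C.
  by rewrite -!rmorphM /= !divfK ?gt_eqF // -rmorphD /= -splitr.
by rewrite lerD // ler_pM ?hS ?hB ?hT ?hD.
Qed.

Lemma expr_eventually_small (rho e : R) : 0 <= rho < 1 -> 0 < e ->
  exists K, rho ^+ K <= e.
Proof.
move=> /andP[r0 r1] e0.
have /cvgrPdist_le/(_ _ e0) : (fun n => rho ^+ n) @ \oo --> (0 : R).
  by apply: cvg_expr; rewrite ger0_norm.
case=> K _ /(_ K (leqnn K)) /=; rewrite sub0r normrN => h.
by exists K; rewrite (le_trans (ler_norm _)).
Qed.

(** The geometric series in -h converges uniformly: its remainder (-h)^K / (1 + h) is at most rho^K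
    / (1 - rho). *)
Lemma poly_approx_inv1 h (rho : R) : poly_approx h -> 0 <= rho < 1 ->
  (forall z, `|z| = 1 -> `|h z| <= rho%:C) ->
  poly_approx (fun z => (1 + h z)^-1).
Proof.
move=> hh /andP[r0 r1] hr; apply: poly_approx_lim => e e0.
have [||K hK] := @expr_eventually_small rho (e * (1 - rho)).
- by rewrite r0 r1.
- by rewrite mulr_gt0 // subr_gt0.
exists (fun z => \sum_(i < K) (- h z) ^+ i).
  elim: K {hK} => [|K IH].
    move=> d d0; exists 0 => z _.
    by rewrite big_ord0 horner0 subrr normr0 ler0c ltW.
  move=> d d0.
  have [T hT] : exists T : {poly C}, forall z, `|z| = 1 ->
      `|1%:P.[z] + (-1)%:P.[z] * (h z * \sum_(i < K) (- h z) ^+ i) - T.[z]| <= d%:C.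
    apply: (poly_approxD (poly_approx_poly _)) => //.
    apply: (poly_approxM (poly_approx_poly _)).
    by apply: poly_approxM hh IH.
  exists T => z z1; move: (hT z z1); rewrite !hornerC big_ord_recl expr0 mulN1r -mulNr mulr_sumr.
  by under [in X in _ -> X]eq_bigr do rewrite /= exprS.
move=> z z1.
have den : (1 - rho)%:C <= `|1 + h z|.
  rewrite -[h z]opprK (le_trans _ (lerB_dist _ _)) // normr1 rmorphB /= lerB //.
  by rewrite normrN hr.
have pos : 0 < `|1 + h z| by rewrite (lt_le_trans _ den) // ltcR subr_gt0.
have nz : 1 + h z != 0 by rewrite -normr_gt0.
have -> : (1 + h z)^-1 - \sum_(i < K) (- h z) ^+ i = (- h z) ^+ K / (1 + h z).
  apply: (mulIf nz); rewrite mulrBl mulVf // divfK //.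
  have := subrX1 (- h z) K; set S := \sum_(i < K) _ => E.
  have -> : S * (1 + h z) = - ((- h z - 1) * S) by ring.
  rewrite -E; ring.
rewrite normrM normfV normrX normrN ler_pdivrMr //.
apply: (@le_trans _ _ (rho%:C ^+ K)); first by rewrite lerXn2r ?nnegrE ?hr // ler0c.
apply: (@le_trans _ _ (e%:C * (1 - rho)%:C)).
  by rewrite -rmorphXn -rmorphM /= lecR.
by rewrite ler_pM2l // ltcR.
Qed.

(** Conservation of energy: for |z| = 1 a layer multiplies the Hermitian form |Q|^2 - |P|^2 by 1 -
    s_0^2 > 0, and its initial value is 1. *)
Lemma schur_norm_den (m : nat) (s : nat -> R) (z : C) :
  (forall i, `|s i| < 1) -> `|z| = 1 ->
  let sc := fun i => (s i)%:C in
  `|(schur_den sc m).[z]| ^+ 2 - `|(schur_num sc m).[z]| ^+ 2 > 0.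
Proof.
move=> s1 z1 /=; elim: m s s1 => [|m IH] s s1.
  by rewrite /schur_num /schur_den /= !hornerE normr1 normr0 expr1n expr0n subr0.
rewrite schur_numS schur_denS.
have := IH (fun i => s i.+1) (fun i => s1 i.+1) => /=.
move: (schur_num _ m) (schur_den _ m) => P Q.
rewrite !hornerE normrM z1 mul1r !normCK !(rmorphD, rmorphM) /= conj_real_complex.
move: P.[z] Q.[z] => p q H.
have -> : (q + (s 0%N)%:C * p) * (Num.conj q + (s 0%N)%:C * Num.conj p) -
  (p + (s 0%N)%:C * q) * (Num.conj p + (s 0%N)%:C * Num.conj q) =
  (1 - s 0%N ^+ 2)%:C * (q * Num.conj q - p * Num.conj p).
  by rewrite rmorphB rmorphXn rmorph1 /=; ring.
by rewrite mulr_gt0 // ltcR subr_gt0 -real_normK ?num_real // expr_lt1.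
Qed.

Lemma schur_den_neq0 (m : nat) (s : nat -> R) (z : C) :
  (forall i, `|s i| < 1) -> `|z| = 1 -> (schur_den (fun i => (s i)%:C) m).[z] != 0.
Proof.
move=> s1 z1; apply/eqP => e; have := schur_norm_den m s1 z1.
by rewrite /= e normr0 expr0n sub0r oppr_gt0 le_gtF ?exprn_ge0.
Qed.

(** In the factorization Q (1 + h), [schur_norm_den] makes [poly_approx_inv1] applicable with rho =
    |s_0|. *)
Lemma poly_approx_schur_den_inv (m : nat) (s : nat -> R) :
  (forall i, `|s i| < 1) ->
  poly_approx (fun z => (schur_den (fun i => (s i)%:C) m).[z]^-1).
Proof.
elim: m s => [|m IH] s s1.
  apply: poly_approx_lim => e e0; exists (fun z => 1%:P.[z]); first exact: poly_approx_poly.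
  by move=> z z1; rewrite /schur_den /= !hornerE invr1 subrr normr0 ler0c ltW.
set sc := fun i => (s i.+1)%:C.
have {}IH : poly_approx (fun z => (schur_den sc m).[z]^-1) by apply: IH => i; apply: s1.
set h := fun z => ((s 0%N)%:C%:P * schur_num sc m).[z] * (schur_den sc m).[z]^-1.
have hh : poly_approx h by apply: poly_approxM => //; apply: poly_approx_poly.
have hr z : `|z| = 1 -> `|h z| <= `|s 0%N|%:C.
  move=> z1; rewrite /h hornerM hornerC -mulrA normrM.
  have -> : `|(s 0%N)%:C| = `|s 0%N|%:C :> C by rewrite normc_def /= expr0n addr0 sqrtr_sqr.
  rewrite ler_piMr ?ler0c // normrM normfV.
  have nz := schur_den_neq0 m (fun i => s1 i.+1) z1.
  rewrite ler_pdivrMr ?normr_gt0 // mul1r.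
  rewrite -(@ler_pXn2r _ 2) ?nnegrE //.
  by rewrite -subr_ge0 ltW //; apply: (schur_norm_den m (fun i => s1 i.+1) z1).
have s01 : 0 <= `|s 0%N| < 1 by rewrite normr_ge0 s1.
have H := poly_approxM (poly_approx_inv1 hh s01 hr) IH.
apply: poly_approx_lim => e e0.
exists (fun z => (1 + h z)^-1 * (schur_den sc m).[z]^-1) => // z z1.
have nz := schur_den_neq0 m (fun i => s1 i.+1) z1.
rewrite schur_denS hornerD /h -invfM mulrDl mul1r divfK //.
by rewrite subrr normr0 ler0c ltW.
Qed.

End Circle.

(** * Complex-valued functions of a real variable *)

Section Cis.
Variable R : realType.

Lemma cisD (a b : R) : cis (a + b) = cis a * cis b :> R[i].
Proof. by rewrite /cis cosD sinD; simpc; congr (_ +i* _); ring. Qed.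

Lemma cis0 : cis 0 = 1 :> R[i].
Proof. by rewrite /cis cos0 sin0. Qed.

Lemma norm_cis (a : R) : `|cis a| = 1 :> R[i].
Proof. by rewrite normc_def /= cos2Dsin2 sqrtr1. Qed.

Lemma cis_neq0 (a : R) : cis a != 0 :> R[i].
Proof. by rewrite -normr_eq0 norm_cis oner_eq0. Qed.

Lemma cisN (a : R) : cis (- a) = (cis a)^-1 :> R[i].
Proof.
apply: (mulIf (cis_neq0 a)).
by rewrite mulVf ?cis_neq0 // -cisD addNr cis0.
Qed.

Lemma cisX (a : R) n : cis a ^+ n = cis (n%:R * a) :> R[i].
Proof.
elim: n => [|n IH]; first by rewrite mul0r cis0.
by rewrite exprS IH -cisD -natr1 mulrDl mul1r addrC.
Qed.

Lemma cis_2pi : cis (2 * pi) = 1 :> R[i].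
Proof. by rewrite /cis -mulrC mulr_natr cos2pi sin2pi. Qed.

Lemma cis_2pin n : cis (2 * pi * n%:R) = 1 :> R[i].
Proof. by rewrite mulrC -cisX cis_2pi expr1n. Qed.

Lemma cis_eq1 (a : R) : 0 <= a < 2 * pi -> cis a = 1 -> a = 0.
Proof.
move=> /andP[a0 a2] [ca sa].
have [api|api] := leP a pi.
  by apply: cos_inj; rewrite ?in_itv /= ?lexx ?a0 ?pi_ge0 ?cos0.
have : cos (2 * pi - a) = cos 0.
  by rewrite cos0 mulrC mulr_natr cosB cos2pi sin2pi mul1r mul0r addr0.
move/cos_inj; rewrite !in_itv /= lexx pi_ge0 => H.
have : 2 * pi - a = 0 by apply: H => //; lra.
lra.
Qed.

End Cis.

Section ComponentwiseContinuity.
Variable R : realType.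
Implicit Types f g : R -> R[i].

Definition Ccontinuous f :=
  continuous (fun t => complex.Re (f t)) /\ continuous (fun t => complex.Im (f t)).

Lemma Ccontinuous_cst (a : R[i]) : Ccontinuous (fun=> a).
Proof. by split=> t; apply: cvg_cst. Qed.

Lemma Ccontinuous_cis (k : R) : Ccontinuous (fun t => cis (k * t)).
Proof.
have lin : continuous (fun t : R => k * t) by move=> t; apply: mulrl_continuous.
split=> t /=.
  exact: (continuous_comp (lin t) (@continuous_cos R _)).
exact: (continuous_comp (lin t) (@continuous_sin R _)).
Qed.

Lemma CcontinuousD f g : Ccontinuous f -> Ccontinuous g ->
  Ccontinuous (fun t => f t + g t).
Proof.
move=> [f1 f2] [g1 g2]; split=> t.
  have -> : (fun t => complex.Re (f t + g t)) = (fun t => complex.Re (f t) + complex.Re (g t)).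
    by apply/funext => x; case: (f x) => ? ?; case: (g x).
  by apply: cvgD; [apply: f1 | apply: g1].
have -> : (fun t => complex.Im (f t + g t)) = (fun t => complex.Im (f t) + complex.Im (g t)).
  by apply/funext => x; case: (f x) => ? ?; case: (g x).
by apply: cvgD; [apply: f2 | apply: g2].
Qed.

Lemma CcontinuousM f g : Ccontinuous f -> Ccontinuous g ->
  Ccontinuous (fun t => f t * g t).
Proof.
move=> [f1 f2] [g1 g2]; split=> t.
  have -> : (fun t => complex.Re (f t * g t)) = (fun t =>
     complex.Re (f t) * complex.Re (g t) - complex.Im (f t) * complex.Im (g t)).
    by apply/funext => x; case: (f x) => ? ?; case: (g x).
  by apply: cvgB; apply: cvgM; [apply: f1 | apply: g1 | apply: f2 | apply: g2].
have -> : (fun t => complex.Im (f t * g t)) = (fun t =>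
   complex.Re (f t) * complex.Im (g t) + complex.Im (f t) * complex.Re (g t)).
  by apply/funext => x; case: (f x) => ? ?; case: (g x).
by apply: cvgD; apply: cvgM; [apply: f1 | apply: g2 | apply: f2 | apply: g1].
Qed.

Lemma CcontinuousV f : (forall t, f t != 0) -> Ccontinuous f ->
  Ccontinuous (fun t => (f t)^-1).
Proof.
move=> f0 [f1 f2].
have n0 t : complex.Re (f t) ^+ 2 + complex.Im (f t) ^+ 2 != 0.
  by have := f0 t; case: (f t) => x y; rewrite eq_complex /= paddr_eq0 ?sqr_ge0 // !sqrf_eq0.
have n1 : continuous (fun t => (complex.Re (f t) ^+ 2 + complex.Im (f t) ^+ 2)^-1).
  move=> t; apply: cvgV => //; apply: cvgD.
    by apply: (@cvgM _ _ _ _ (fun t => complex.Re (f t))); apply: f1.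
  by apply: (@cvgM _ _ _ _ (fun t => complex.Im (f t))); apply: f2.
split=> t.
  have -> : (fun t => complex.Re (f t)^-1) = (fun t =>
     complex.Re (f t) * (complex.Re (f t) ^+ 2 + complex.Im (f t) ^+ 2)^-1).
    by apply/funext => x; case: (f x).
  by apply: cvgM; [apply: f1 | apply: n1].
have -> : (fun t => complex.Im (f t)^-1) = (fun t =>
   - (complex.Im (f t) * (complex.Re (f t) ^+ 2 + complex.Im (f t) ^+ 2)^-1)).
  by apply/funext => x; case: (f x).
by apply: cvgN; apply: cvgM; [apply: f2 | apply: n1].
Qed.

Lemma Ccontinuous_horner (T : {poly R[i]}) f : Ccontinuous f ->
  Ccontinuous (fun t => T.[f t]).
Proof.
move=> cf; elim/poly_ind: T => [|T c IH].
  have -> : (fun t => (0 : {poly R[i]}).[f t]) = fun=> 0 by apply/funext => t; rewrite horner0.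
  exact: Ccontinuous_cst.
have -> : (fun t => (T * 'X + c%:P).[f t]) = fun t => T.[f t] * f t + c.
  by apply/funext => t; rewrite hornerD hornerMX hornerC.
by apply: CcontinuousD; [apply: CcontinuousM | apply: Ccontinuous_cst].
Qed.

End ComponentwiseContinuity.

(** * Componentwise integration over an open interval *)

Section CIntegral.
Variable R : realType.
Notation mu := (@lebesgue_measure R).
Variables a b : R.
Hypothesis ab : a < b.
Notation D := (`]a, b[%classic : set R).

Lemma continuous_integrable_oo (f : R -> R) : continuous f ->
  mu.-integrable D (EFin \o f).
Proof.
move=> cf.
have H : mu.-integrable `[a, b] (EFin \o f).
  apply: continuous_compact_integrable; first exact: segment_compact.
  exact: continuous_subspaceT.
by apply: (integrableS _ _ _ H) => //; apply: subset_itv_oo_cc.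
Qed.

Lemma CintegralD (f g : R -> R[i]) : Ccontinuous f -> Ccontinuous g ->
  Cintegral D (fun t => f t + g t) = Cintegral D f + Cintegral D g.
Proof.
move=> [f1 f2] [g1 g2]; rewrite /Cintegral.
have -> : (fun t => complex.Re (f t + g t)) = (fun t => complex.Re (f t) + complex.Re (g t)).
  by apply/funext => x; case: (f x) => ? ?; case: (g x).
have -> : (fun t => complex.Im (f t + g t)) = (fun t => complex.Im (f t) + complex.Im (g t)).
  by apply/funext => x; case: (f x) => ? ?; case: (g x).
by rewrite !RintegralD //; apply: continuous_integrable_oo.
Qed.

Lemma CintegralZ (c : R[i]) (f : R -> R[i]) : Ccontinuous f ->
  Cintegral D (fun t => c * f t) = c * Cintegral D f.
Proof.
move=> [f1 f2]; rewrite /Cintegral; case: c => [c d].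
have i1 := continuous_integrable_oo f1; have i2 := continuous_integrable_oo f2.
have s (k : R) (g : R -> R) : continuous g -> continuous (fun t => k * g t).
  by move=> cg t; apply: cvgM; [apply: cvg_cst | apply: cg].
have -> : (fun t => complex.Re ((c +i* d) * f t)) = (fun t => c * complex.Re (f t) - d * complex.Im (f t)).
  by apply/funext => x; case: (f x).
have -> : (fun t => complex.Im ((c +i* d) * f t)) = (fun t => c * complex.Im (f t) + d * complex.Re (f t)).
  by apply/funext => x; case: (f x).
rewrite RintegralB ?RintegralD ?RintegralZl //; try exact/continuous_integrable_oo/s.
Qed.

Lemma Rintegral_bound (f : R -> R) e : continuous f -> (forall t, `|f t| <= e) ->
  `|\int[mu]_(t in D) f t| <= e * (b - a).
Proof.
move=> cf fe.
have ci (g : R -> R) : continuous g -> mu.-integrable D (EFin \o g) by apply: continuous_integrable_oo.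
have cn : continuous (fun t => `|f t|).
  by move=> t; apply: cvg_norm; apply: cf.
apply: (@le_trans _ _ (\int[mu]_(t in D) `|f t|)).
  by apply: le_normr_Rintegral => //; apply: ci.
apply: (@le_trans _ _ (\int[mu]_(t in D) e)).
  apply: le_Rintegral => //; [exact: ci | apply: ci => t; exact: cvg_cst].
rewrite Rintegral_cst //= lebesgue_measure_itv /= lte_fin ab.
by rewrite -EFinD.
Qed.

Lemma Cintegral_small (f : R -> R[i]) : Ccontinuous f ->
  (forall e : R, 0 < e -> exists g : R -> R[i],
     [/\ Ccontinuous g, Cintegral D g = 0 & forall t, `|f t - g t| <= e%:C]) ->
  Cintegral D f = 0.
Proof.
move=> cf H.
have K (e : R) : 0 < e -> `|complex.Re (Cintegral D f)| <= e /\ `|complex.Im (Cintegral D f)| <= e.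
  move=> e0; have ba : 0 < b - a by rewrite subr_gt0.
  have [|g [cg g0 fg]] := H (e / (b - a)); first by rewrite divr_gt0.
  have cN : Ccontinuous (fun t => -1 * g t).
    by apply: CcontinuousM => //; apply: Ccontinuous_cst.
  have cfg := CcontinuousD cf cN.
  have -> : Cintegral D f = Cintegral D (fun t => f t + -1 * g t).
    by rewrite CintegralD // CintegralZ // g0 mulr0 addr0.
  have e' : e = e / (b - a) * (b - a) by rewrite divfK // gt_eqF.
  have bnd t : `|complex.Re (f t + -1 * g t)| <= e / (b - a) /\
               `|complex.Im (f t + -1 * g t)| <= e / (b - a).
    move: (fg t); rewrite mulN1r normc_def lecR; case: (_ - _) => x y /= h.
    by split; apply: le_trans h; rewrite -sqrtr_sqr ler_sqrt ?addr_ge0 ?sqr_ge0 //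
      ?lerDl ?lerDr sqr_ge0.
  split; rewrite [X in _ <= X]e' /=; apply: Rintegral_bound; try by case: cfg.
    by move=> t; case: (bnd t).
  by move=> t; case: (bnd t).
apply/eqP; rewrite eq_complex /= -!normr_le0; apply/andP; split.
  by apply/ler_addgt0Pr => e e0; rewrite add0r; case: (K e e0).
by apply/ler_addgt0Pr => e e0; rewrite add0r; case: (K e e0).
Qed.

Lemma Rintegral_derive (f F : R -> R) : continuous f ->
  (forall t, is_derive t (1 : R) F (f t)) ->
  \int[mu]_(t in D) f t = F b - F a.
Proof.
move=> cf dF; have i1 := continuous_integrable_oo cf.
have i2 : mu.-integrable `]a, b] (EFin \o f).
  have H : mu.-integrable `[a, b] (EFin \o f).
    apply: continuous_compact_integrable; first exact: segment_compact.
    exact: continuous_subspaceT.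
  by apply: (integrableS _ _ _ H) => //; apply: subset_itv_oc_cc.
rewrite Rintegral_itv_bndo_bndc // Rintegral_itv_obnd_cbnd // /Rintegral.
have cF : continuous F.
  move=> t; apply/differentiable_continuous/derivable1_diffP.
  by have [] := dF t.
rewrite (@continuous_FTC2 _ _ F) //.
- exact: continuous_subspaceT.
- split=> [t _||]; first by have [] := dF t.
    by apply: cvg_at_right_filter; apply: cF.
  by apply: cvg_at_left_filter; apply: cF.
by move=> t _; rewrite derive1E; have [_] := dF t.
Qed.

Lemma Cintegral_cis (k : R) : k != 0 -> cis (k * (b - a)) = 1 ->
  Cintegral D (fun t => cis (k * t)) = 0.
Proof.
move=> k0 per; rewrite /Cintegral /=.
have [c1 c2] := Ccontinuous_cis k.
have d1 t : is_derive t (1 : R) (fun t => k^-1 * sin (k * t)) (cos (k * t)).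
  apply: is_derive_eq; rewrite /GRing.scale /= mulr1. field.
  done.
have d2 t : is_derive t (1 : R) (fun t => - k^-1 * cos (k * t)) (sin (k * t)).
  apply: is_derive_eq; rewrite /GRing.scale /= mulr1; field.
  done.
rewrite (Rintegral_derive c1 d1) (Rintegral_derive c2 d2).
have : cis (k * b) = cis (k * a) by rewrite -[b](subrK a) mulrDr cisD per mul1r.
by case=> -> ->; rewrite !subrr.
Qed.

End CIntegral.

(** * Fourier coefficients *)

Section Fourier.
Variable R : realType.
Notation mu := (@lebesgue_measure R).

Lemma Ccontinuous_sum n (f : nat -> R -> R[i]) : (forall i, Ccontinuous (f i)) ->
  Ccontinuous (fun t => \sum_(i < n) f i t).
Proof.
move=> cf; elim: n => [|n IH].
  have -> : (fun t => \sum_(i < 0) f i t) = fun=> 0 by apply/funext => t; rewrite big_ord0.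
  exact: Ccontinuous_cst.
have -> : (fun t => \sum_(i < n.+1) f i t) = fun t => \sum_(i < n) f i t + f n t.
  by apply/funext => t; rewrite big_ord_recr.
exact: CcontinuousD.
Qed.

Lemma Cintegral_sum0 (a b : R) n (f : nat -> R -> R[i]) : a < b ->
  (forall i, Ccontinuous (f i)) -> (forall i, Cintegral `]a, b[ (f i) = 0) ->
  Cintegral `]a, b[ (fun t => \sum_(i < n) f i t) = 0.
Proof.
move=> ab cf f0; elim: n => [|n IH].
  have -> : (fun t => \sum_(i < 0) f i t) = fun t => 0 * f 0%N t.
    by apply/funext => t; rewrite big_ord0 mul0r.
  by rewrite CintegralZ // mul0r.
have -> : (fun t => \sum_(i < n.+1) f i t) = fun t => \sum_(i < n) f i t + f n t.
  by apply/funext => t; rewrite big_ord_recr.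
by rewrite CintegralD ?IH ?f0 ?addr0 //; apply: Ccontinuous_sum.
Qed.

(** The point [c] will be the frequency 0, where the data are arbitrary. The measurability of [f] is
    inherited from [g] on the punctured interval. *)
Lemma eq_Cintegral_off_point (a b c : R) (f g : R -> R[i]) : a < b -> Ccontinuous g ->
  (forall t, a < t < b -> t != c -> f t = g t) ->
  Cintegral `]a, b[ f = Cintegral `]a, b[ g.
Proof.
move=> ab cg fg.
have K (F G : R -> R) : continuous G -> (forall t, a < t < b -> t != c -> F t = G t) ->
    \int[mu]_(t in `]a, b[) F t = \int[mu]_(t in `]a, b[) G t.
  move=> cG FG; rewrite /Rintegral; congr fine.
  have mD : measurable (`]a, b[ `\ c : set R) by apply: measurableD.
  have mG : measurable_fun (`]a, b[ `\ c : set R) (fun t => (G t)%:E).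
    apply/measurable_EFinP; apply: measurable_funTS; exact: continuous_measurable_fun.
  have EFG t : (`]a, b[ `\ c) t -> (F t)%:E = (G t)%:E.
    by move=> /= [tab /eqP tc]; rewrite FG.
  have mF : measurable_fun (`]a, b[ `\ c : set R) (fun t => (F t)%:E).
    apply: (eq_measurable_fun (fun t => (G t)%:E) _ mG) => t tD.
    by rewrite (EFG t (set_mem tD)).
  rewrite -(integral_setD1 mD mG) -(integral_setD1 mD mF).
  by apply: eq_integral => t /set_mem /EFG ->.
case: cg => c1 c2; rewrite /Cintegral; congr (_ +i* _); apply: K => // t tab tc; by rewrite fg.
Qed.

Variables (s : nat -> R) (m N : nat) (A : {poly R}) (Delta wmin : R) (rho : R -> R[i]).
Hypothesis s1 : forall i, `|s i| < 1.
Hypothesis D0 : 0 < Delta.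
Hypothesis sA : (size A <= N.+1)%N.
Hypothesis hA : 'X^(N.+1) %| A * schur_den s m - schur_num s m.
Let sc i : R[i] := (s i)%:C.
Let p := pi / Delta.
Let z w : R[i] := cis (2 * Delta * w).
Hypothesis rhoE : forall w, wmin < w < wmin + p -> w != 0 ->
  rho w = (schur_num sc m).[z w] / (schur_den sc m).[z w].

(** On the circle P/Q = A(z) - z^(N+1) H(z)/Q(z). The last term is uniformly close to z^(N+1) T(z),
    whose modes exceed N, so that only the j-th term of [A] meets the mode j. *)
Lemma fourier_coef j : (j <= N)%N -> alg_alpha wmin p rho j = (A`_j)%:C.
Proof.
move=> jN.
have p0 : 0 < p by rewrite divr_gt0 ?pi_gt0.
have wp : wmin < wmin + p by rewrite ltrDl.
have pD : pi / p = Delta by rewrite /p invf_div mulrCA divff ?mulr1 // gt_eqF ?pi_gt0.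
have z1 w : `|z w| = 1 by apply: norm_cis.
have rE := rhoE; set P := schur_num sc m in rE *; set Q := schur_den sc m in rE *.
have Qz w : Q.[z w] != 0 by apply: schur_den_neq0.
have cz : Ccontinuous z by apply: Ccontinuous_cis.
have cQ : Ccontinuous (fun w => Q.[z w]^-1).
  by apply: CcontinuousV => //; apply: Ccontinuous_horner.
have [H hH] : exists H : {poly R[i]}, map_poly (real_complex R) A * Q - P = H * 'X^(N.+1).
  move: hA => /dvdpP[H /(congr1 (map_poly (real_complex R)))].
  have [e1 e2] := map_schur_pair (real_complex R) s m.
  rewrite rmorphB !rmorphM /= e1 e2 map_polyXn => E.
  by exists (map_poly (real_complex R) H).
pose E w : R[i] := cis (- (2 * j%:R * (pi / p) * w)).
have cE : Ccontinuous E.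
  have -> : E = fun w => cis (- (2 * j%:R * (pi / p)) * w).
    by apply/funext => w; rewrite /E mulNr.
  exact: Ccontinuous_cis.
pose F w := P.[z w] * Q.[z w]^-1 * E w.
have cF : Ccontinuous F.
  by apply: CcontinuousM => //; apply: CcontinuousM => //; apply: Ccontinuous_horner.
have zE w i : z w ^+ i * E w = cis (2 * Delta * (i%:R - j%:R) * w).
  by rewrite /z /E cisX -cisD pD; congr cis; ring.
pose tr (c : R[i]) (k : R) w := c * cis (2 * Delta * k * w).
have ctr c k : Ccontinuous (tr c k).
  by apply: CcontinuousM; [apply: Ccontinuous_cst | apply: Ccontinuous_cis].
have itr c (i l : nat) : i != l -> Cintegral `]wmin, (wmin + p)[ (tr c (i%:R - l%:R)) = 0.
  move=> il; rewrite /tr CintegralZ ?Cintegral_cis ?mulr0 //; try exact: Ccontinuous_cis.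
    by rewrite !mulf_neq0 ?subr_eq0 ?eqr_nat // gt_eqF.
  rewrite addrAC subrr add0r.
  have -> : 2 * Delta * (i%:R - l%:R) * p = 2 * pi * i%:R - 2 * pi * l%:R.
    by rewrite /p; field; rewrite gt_eqF.
  by rewrite cisD cisN !cis_2pin invr1 mulr1.
have aA i : (map_poly (real_complex R) A)`_i = (A`_i)%:C by rewrite coef_map.
pose g w := F w - (A`_j)%:C.
have g0 : Cintegral `]wmin, (wmin + p)[ g = 0.
  have app : poly_approx (fun x => - H.[x] * Q.[x]^-1).
    apply: poly_approxM; last exact: poly_approx_schur_den_inv.
    have -> : (fun x => - H.[x]) = fun x => (- H).[x] by apply/funext => x; rewrite hornerN.
    exact: poly_approx_poly.
  apply: Cintegral_small => //.
    by apply: CcontinuousD => //; apply: Ccontinuous_cst.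
  move=> e /app [T hT].
  (* [g1] is A(z) times the test exponential without its j-th term, [g2] is z^(N+1) T(z) times the
     same. Every term left is a multiple of a nonconstant exponential, integrated over full
     periods. *)
  pose g1 w := \sum_(i < N.+1) tr (if i == j :> nat then 0 else (A`_i)%:C) (i%:R - j%:R) w.
  pose g2 w := \sum_(i < size T) tr T`_i ((N.+1 + i)%:R - j%:R) w.
  have cg1 : Ccontinuous g1.
    by apply: (@Ccontinuous_sum _ (fun i => tr (if i == j then 0 else (A`_i)%:C) (i%:R - j%:R))).
  have cg2 : Ccontinuous g2.
    by apply: (@Ccontinuous_sum _ (fun i => tr T`_i ((N.+1 + i)%:R - j%:R))).
  exists (fun w => g1 w + g2 w); split; first exact: CcontinuousD.
    rewrite CintegralD //.
    rewrite (@Cintegral_sum0 _ _ _ (fun i => tr (if i == j then 0 else (A`_i)%:C) (i%:R - j%:R))) //.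
      rewrite (@Cintegral_sum0 _ _ _ (fun i => tr T`_i ((N.+1 + i)%:R - j%:R))) ?addr0 // => i.
      by apply: itr; lia.
    move=> i; have [->|ij] := eqVneq i j; last exact: itr.
    by rewrite /tr CintegralZ ?mul0r //; apply: Ccontinuous_cis.
  move=> w.
  have sumA : \sum_(i < N.+1) (A`_i)%:C * z w ^+ i = (map_poly (real_complex R) A).[z w].
    rewrite (@horner_coef_wide _ N.+1); last by rewrite (leq_trans (size_poly _ _)).
    by apply: eq_bigr => i _; rewrite aA.
  have eg1 : g1 w = (map_poly (real_complex R) A).[z w] * E w - (A`_j)%:C.
    rewrite -sumA mulr_suml /g1 /tr.
    have jN1 : (j < N.+1)%N by [].
    rewrite (bigD1 (Ordinal jN1)) //= [in RHS](bigD1 (Ordinal jN1)) //= eqxx mul0r add0r.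
    rewrite -mulrA zE subrr mulr0 mul0r cis0 mulr1 addrAC subrr add0r.
    by apply: eq_bigr => i ij; rewrite -[RHS]mulrA zE ifN.
  have eg2 : g2 w = z w ^+ N.+1 * T.[z w] * E w.
    rewrite horner_coef mulr_sumr mulr_suml /g2 /tr; apply: eq_bigr => i _.
    by rewrite -zE exprD; ring.
  have eF : F w = (map_poly (real_complex R) A).[z w] * E w
                  + z w ^+ N.+1 * (- H.[z w] * Q.[z w]^-1) * E w.
    have := congr1 (fun q : {poly R[i]} => q.[z w]) hH.
    rewrite /F !hornerE /= => hz.
    have -> : P.[z w] = (map_poly (real_complex R) A).[z w] * Q.[z w] - H.[z w] * z w ^+ N.+1.
      by rewrite -hz opprB addrC subrK.
    by field.
  rewrite /g eF eg1 eg2.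
  set a := _.[z w] * E w; set x := z w ^+ N.+1.
  have -> : a + x * (- H.[z w] / Q.[z w]) * E w - (A`_j)%:C -
     (a - (A`_j)%:C + x * T.[z w] * E w) = (- H.[z w] / Q.[z w] - T.[z w]) * (x * E w) by ring.
  by rewrite normrM zE norm_cis mulr1 hT.
rewrite /alg_alpha.
rewrite (@eq_Cintegral_off_point _ _ 0 _ F) //; last by move=> w hw w0; rewrite rE.
have -> : F = fun w => (A`_j)%:C + g w.
  by apply/funext => w; rewrite /g addrC subrK.
rewrite CintegralD ?g0 ?addr0 //.
- rewrite /Cintegral /= Rintegral_cst // Rintegral_cst //= lebesgue_measure_itv /= lte_fin wp.
  rewrite -EFinD /= addrAC subrr add0r mul0r complexr0 -rmorphM /= mulrCA mulVf ?mulr1 //.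
  by rewrite gt_eqF.
- exact: Ccontinuous_cst.
- by apply: CcontinuousD => //; apply: Ccontinuous_cst.
Qed.

End Fourier.

(** * Plane waves *)

Section Waves.
Variable R : realType.

(** The equation holds only inside a layer while the matching is done at its ends, so a conserved
    quantity is compared there through one-sided limits. *)
Lemma derive0_limits (f : R -> R) (a b la lb : R) : a < b ->
  (forall t, a < t < b -> is_derive t (1 : R) f 0) ->
  f @ a^'+ --> la -> f @ b^'- --> lb -> la = lb.
Proof.
move=> ab df fa fb.
have cst s t : a < s -> s < t -> t < b -> f s = f t.
  move=> as_ st tb.
  have [||c _] := @MVT R f (fun=> 0) s t st.
  - by move=> y; rewrite in_itv /= => /andP[y1 y2]; apply: df; lra.
  - apply: derivable_within_continuous => y; rewrite in_itv /= => /andP[y1 y2].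
    by have [|] := df y; first by lra.
  by rewrite mul0r => /eqP; rewrite subr_eq0 => /eqP.
set c := (a + b) / 2.
have ac : a < c by rewrite /c; lra.
have cb : c < b by rewrite /c; lra.
have -> : la = f c.
  apply: (cvg_unique _ fa) => //; apply: cvg_near_cst.
  by near=> t; apply: cst.
apply: (cvg_unique _ _ fb) => //; apply: cvg_near_cst.
by near=> t; apply/esym; apply: cst.
Unshelve. all: by end_near. Qed.

Lemma real_wave_propagation (f g : R -> R) (a b k fa ga fb gb : R) : a < b ->
  (forall t, a < t < b -> is_derive t (1 : R) f (g t)) ->
  (forall t, a < t < b -> is_derive t (1 : R) g (- k ^+ 2 * f t)) ->
  f @ a^'+ --> fa -> g @ a^'+ --> ga -> f @ b^'- --> fb -> g @ b^'- --> gb ->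
  k * fb = k * fa * cos (k * (b - a)) + ga * sin (k * (b - a)) /\
  gb = ga * cos (k * (b - a)) - k * fa * sin (k * (b - a)).
Proof.
move=> ab df dg fa_ ga_ fb_ gb_.
pose C t := cos (k * t); pose S t := sin (k * t).
have cC : continuous C by have [] := Ccontinuous_cis k.
have cS : continuous S by have [] := Ccontinuous_cis k.
have dC t : is_derive t (1 : R) C (- k * S t).
  by apply: is_derive_eq; rewrite /GRing.scale /= mulr1 /S; ring.
have dS t : is_derive t (1 : R) S (k * C t).
  by apply: is_derive_eq; rewrite /GRing.scale /= mulr1 /C; ring.
(* Rotating (k f, g) by the phase k t freezes it: both combinations have derivative 0. Keeping k f
   instead of f avoids a division by k. *)
have E1 : k * (fa * C a) - ga * S a = k * (fb * C b) - gb * S b.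
  apply: (@derive0_limits (fun t => k * (f t * C t) - g t * S t) a b) => //.
  - move=> t tab; have d1 := df t tab; have d2 := dg t tab.
    by apply: is_derive_eq; rewrite /GRing.scale /=; ring.
  - apply: cvgB; last by apply: cvgM => //; apply: cvg_at_right_filter; apply: cS.
    apply: cvgM; first exact: cvg_cst.
    by apply: cvgM => //; apply: cvg_at_right_filter; apply: cC.
  apply: cvgB; last by apply: cvgM => //; apply: cvg_at_left_filter; apply: cS.
  apply: cvgM; first exact: cvg_cst.
  by apply: cvgM => //; apply: cvg_at_left_filter; apply: cC.
have E2 : k * (fa * S a) + ga * C a = k * (fb * S b) + gb * C b.
  apply: (@derive0_limits (fun t => k * (f t * S t) + g t * C t) a b) => //.
  - move=> t tab; have d1 := df t tab; have d2 := dg t tab.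
    by apply: is_derive_eq; rewrite /GRing.scale /=; ring.
  - apply: cvgD; last by apply: cvgM => //; apply: cvg_at_right_filter; apply: cC.
    apply: cvgM; first exact: cvg_cst.
    by apply: cvgM => //; apply: cvg_at_right_filter; apply: cS.
  apply: cvgD; last by apply: cvgM => //; apply: cvg_at_left_filter; apply: cC.
  apply: cvgM; first exact: cvg_cst.
  by apply: cvgM => //; apply: cvg_at_left_filter; apply: cS.
have pb : C b ^+ 2 + S b ^+ 2 = 1 by apply: cos2Dsin2.
rewrite mulrBr cosB sinB -/(C a) -/(C b) -/(S a) -/(S b); split.
  have -> : k * fb = k * fb * (C b ^+ 2 + S b ^+ 2) by rewrite pb mulr1.
  transitivity ((k * (fb * C b) - gb * S b) * C b + (k * (fb * S b) + gb * C b) * S b); first by ring.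
  rewrite -E1 -E2; ring.
have -> : gb = gb * (C b ^+ 2 + S b ^+ 2) by rewrite pb mulr1.
transitivity ((k * (fb * S b) + gb * C b) * C b - (k * (fb * C b) - gb * S b) * S b); first by ring.
rewrite -E1 -E2; ring.
Qed.

(** The combinations u' + i k u and u' - i k u isolate the right-moving and the left-moving wave,
    and each only picks up a phase across a layer. *)
Lemma wave_propagation (u v : R -> R[i]) (a b k : R) (ua va ub vb : R[i]) : a < b ->
  (forall t, a < t < b -> Cis_derive u t (v t)) ->
  (forall t, a < t < b -> Cis_derive v t (- (k ^+ 2)%:C * u t)) ->
  Ccvg (a^'+) u ua -> Ccvg (a^'+) v va -> Ccvg (b^'-) u ub -> Ccvg (b^'-) v vb ->
  vb + 'i * k%:C * ub = cis (k * (b - a)) * (va + 'i * k%:C * ua) /\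
  vb - 'i * k%:C * ub = cis (- (k * (b - a))) * (va - 'i * k%:C * ua).
Proof.
move=> ab du dv [ua1 ua2] [va1 va2] [ub1 ub2] [vb1 vb2].
have [|e1 e2] := @real_wave_propagation _ _ a b k _ _ _ _ ab
  (fun t h => (du t h).1) _ ua1 va1 ub1 vb1.
  move=> t /dv [d _]; apply: is_derive_eq d _.
  by case: (u t) => x y /=; ring.
have [|e3 e4] := @real_wave_propagation _ _ a b k _ _ _ _ ab
  (fun t h => (du t h).2) _ ua2 va2 ub2 vb2.
  move=> t /dv [_ d]; apply: is_derive_eq d _.
  by case: (u t) => x y /=; ring.
move: e1 e2 e3 e4; set th := k * (b - a).
case: ua va ub vb {ua1 ua2 va1 va2 ub1 ub2 vb1 vb2} => [u1 u2] [v1 v2] [y1 y2] [w1 w2] /=.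
move=> e1 e2 e3 e4; rewrite /cis cosN sinN; simpc.
by split; congr (_ +i* _); rewrite ?e2 ?e4 ?e1 ?e3; ring.
Qed.

(** Turns the radiation condition, which speaks of [u] alone, into a relation between [u] and its
    derivative. *)
Lemma plane_wave_derive (u : R -> R[i]) (t k : R) (v A : R[i]) :
  (\near t, u t = A * cis (k * t)) -> Cis_derive u t v ->
  v = 'i * k%:C * u t.
Proof.
move=> near_u [d1 d2].
have d3 : is_derive t (1 : R) (fun s => complex.Re (A * cis (k * s)))
    (- k * complex.Im (A * cis (k * t))).
  case: A {near_u} => [p q] /=; apply: is_derive_eq.
  by rewrite /GRing.scale /= ?mulr1; ring.
have d4 : is_derive t (1 : R) (fun s => complex.Im (A * cis (k * s)))
    (k * complex.Re (A * cis (k * t))).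
  case: A {near_u d3} => [p q] /=; apply: is_derive_eq.
  by rewrite /GRing.scale /= ?mulr1; ring.
have n1 : \near t, complex.Re (A * cis (k * t)) = complex.Re (u t).
  by apply: filterS near_u => s ->.
have n2 : \near t, complex.Im (A * cis (k * t)) = complex.Im (u t).
  by apply: filterS near_u => s ->.
have d5 := near_eq_is_derive n1 d3; have d6 := near_eq_is_derive n2 d4.
rewrite (nbhs_singleton near_u).
have E1 : complex.Re v = - k * complex.Im (A * cis (k * t)).
  by rewrite -(@derive_val _ _ _ _ _ _ _ d1) -(@derive_val _ _ _ _ _ _ _ d5).
have E2 : complex.Im v = k * complex.Re (A * cis (k * t)).
  by rewrite -(@derive_val _ _ _ _ _ _ _ d2) -(@derive_val _ _ _ _ _ _ _ d6).
rewrite [v]complexE E1 E2; case: (A * _) => p q /=; simpc; congr (_ +i* _); ring.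
Qed.

(** Carries that relation to the end points [x 0] and [x n] of the two half-lines. *)
Lemma Ccvg_wave_limit (F : set_system R) (u v : R -> R[i]) (k : R) (y l : R[i]) :
  ProperFilter F -> Ccvg F u y -> Ccvg F v l ->
  (\forall t \near F, v t = 'i * k%:C * u t) -> l = 'i * k%:C * y.
Proof.
move=> PF [u1 u2] [v1 v2] near_v.
have E1 : complex.Re l = - k * complex.Im y.
  apply: (cvg_unique _ v1) => //.
  have : (fun t => - k * complex.Im (u t)) @ F --> - k * complex.Im y.
    by apply: cvgM => //; apply: cvg_cst.
  apply: cvg_trans; apply: near_eq_cvg.
  by apply: filterS near_v => t ->; case: (u t) => p q /=; ring.
have E2 : complex.Im l = k * complex.Re y.
  apply: (cvg_unique _ v2) => //.
  have : (fun t => k * complex.Re (u t)) @ F --> k * complex.Re y.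
    by apply: cvgM => //; apply: cvg_cst.
  apply: cvg_trans; apply: near_eq_cvg.
  by apply: filterS near_v => t ->; case: (u t) => p q /=; ring.
rewrite [l]complexE E1 E2; case: y {u1 u2 E1 E2} => p q /=; simpc; congr (_ +i* _); ring.
Qed.

Lemma Ccvg_right (u : R -> R[i]) (t : R) l : Ccvg (nbhs t) u l -> Ccvg (t^'+) u l.
Proof. by move=> [? ?]; split; apply: cvg_at_right_filter. Qed.

Lemma Ccvg_left (u : R -> R[i]) (t : R) l : Ccvg (nbhs t) u l -> Ccvg (t^'-) u l.
Proof. by move=> [? ?]; split; apply: cvg_at_left_filter. Qed.

End Waves.

Section StepSpeed.
Variables (R : realType) (n : nat) (c x : nat -> R).
Hypothesis hn : (0 < n)%N.
Hypothesis hx : forall j, (j < n)%N -> x j < x j.+1.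

Lemma increasing_le i j : (i <= j)%N -> (j <= n)%N -> x i <= x j.
Proof.
elim: j => [|j IH]; first by rewrite leqn0 => /eqP ->.
rewrite leq_eqVlt => /predU1P[->//|ij] jn.
by rewrite (le_trans (IH ij (ltnW jn))) // ltW // hx.
Qed.

Lemma step_speedE i t : (i <= n)%N -> ((0 < i)%N -> x i < t) ->
  ((i < n)%N -> t <= x i.+1) -> step_speed n c x t = c i.
Proof.
move=> im h1 h2.
have gt j : (0 < i)%N -> (j <= i)%N -> x j < t.
  by move=> i0 ji; rewrite (le_lt_trans _ (h1 i0)) // increasing_le.
have le j : (i < j)%N -> (j <= n)%N -> t <= x j.
  by move=> ij jn; rewrite (le_trans (h2 _)) ?increasing_le // (leq_trans ij).
rewrite /step_speed !indicE !mem_setE !in_itv /= andbT.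
have -> : (t <= x 1%N) = (i == 0%N).
  case: i im h1 h2 gt le => [|i] im h1 h2 gt le /=; first by rewrite le.
  by apply/negbTE; rewrite -ltNge gt.
have -> : (x n < t) = (i == n).
  have [e|ne] := eqVneq i n; first by rewrite gt // e.
  by apply/negbTE; rewrite -leNgt le // ltn_neqAle ne.
have -> : \sum_(1 <= j < n) c j * \1_(`]x j, x j.+1]) t = \sum_(1 <= j < n | j == i) c j.
  rewrite [RHS]big_mkcond; apply: eq_big_nat => j /andP[j1 jn].
  rewrite indicE mem_setE in_itv /=; case: ltngtP => [ji|ij|ji].
  - by rewrite [t <= _]leNgt (gt j.+1) ?andbF ?mulr0 // (leq_ltn_trans _ ji).
  - by rewrite ltNge le ?mulr0 // ltnW.
  - rewrite ji in j1 jn *; by rewrite h1 // h2 // mulr1.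
have [i0|i0] := eqVneq i 0%N.
  rewrite i0 ltn_eqF // mulr1 mulr0 addr0 big_nat_cond big1 ?addr0 // => j.
  by case/andP => /andP[j1 _] /eqP j0; rewrite j0 in j1.
rewrite mulr0 add0r.
have [e|ne] := eqVneq i n.
  rewrite mulr1 -e big_nat_cond big1 ?add0r // => j.
  by case/andP => /andP[_ j1] /eqP j0; rewrite j0 ltnn in j1.
rewrite mulr0 addr0 -big_filter (_ : [seq j <- _ | _] = [:: i]) ?big_seq1 //.
rewrite filter_pred1_uniq ?iota_uniq // mem_index_iota lt0n i0 ltn_neqAle ne im //.
Qed.
End StepSpeed.

(** * Scattering by a layered medium *)

Section Scattering.
Variables (R : realType) (n : nat) (c x : nat -> R) (xs Delta0 : R).
Hypothesis hn : (0 < n)%N.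
Hypothesis hc : forall j, (j <= n)%N -> 0 < c j.
Hypothesis hx : forall j, (j < n)%N -> x j < x j.+1.
Hypothesis hxs : x 0%N < xs < x 1%N.
Hypothesis hD : forall j, (1 <= j <= n)%N -> (x j - x j.-1) / c j.-1 = Delta0.

(** [reflection i] belongs to the interface [x i.+1]; the value 0 from [n] on means that nothing
    more is reflected. The sign makes (1 + r)/(1 - r) the ratio of consecutive speeds, as Step 4
    expects. *)
Definition reflection i : R :=
  if (i < n)%N then (c i.+1 - c i) / (c i.+1 + c i) else 0.

Lemma reflection_lt1 i : `|reflection i| < 1.
Proof.
rewrite /reflection; case: ifP => [im|]; last by rewrite normr0.
have p := hc im; have q := hc (ltnW im).
have s : 0 < c i.+1 + c i by apply: addr_gt0.
by rewrite normrM normfV (gtr0_norm s) ltr_pdivrMr // mul1r ltr_norml; apply/andP; split; lra.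
Qed.

Let rc i : R[i] := (reflection i)%:C.

Section Solution.
Variables (w : R) (u : R -> R[i]).
Hypothesis hu : outgoing_solution n c x w u.

Let k j := w / c j.
Let z : R[i] := cis (2 * Delta0 * w).

Lemma outgoing_surrogate (d : R -> R[i]) : d w = u xs ->
  surrogate (c 0%N) (x 0%N) xs d w =
  (schur_num rc n).[z] / (schur_den rc n).[z].
Proof.
move=> dw; case: hu => [cu [[u' [du ddu [l [l1 l2]]]] [[B uB] [A uA]]]].
have hle := increasing_le hx.
have hlt i j : (i < j)%N -> (j <= n)%N -> x i < x j.
  by move=> ij jn; rewrite (lt_le_trans (hx (leq_trans ij jn))) // hle.
(* The right-hand limit of u' at [x j]. At the source it is the left limit minus 1, and the value
   [u' (x 0)] carries no information. *)
pose W j := if j == 0%N then l - 1 else u' (x j).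
have Wright j : (j <= n)%N -> Ccvg ((x j)^'+) u' (W j).
  rewrite /W; case: eqP => [-> _ //|/eqP j0 jn]; apply: Ccvg_right.
  by have [] := du (x j); first by rewrite gt_eqF // hlt // lt0n.
have layer j t : (j < n)%N -> x j < t < x j.+1 ->
    Cis_derive u t (u' t) /\ Cis_derive u' t (- (k j ^+ 2)%:C * u t).
  move=> jn /andP[t1 t2]; split.
    have [|//] := du t.
    by rewrite gt_eqF // (le_lt_trans (hle 0%N j _ _) t1) // ltnW.
  have ss : step_speed n c x t = c j.
    by apply: step_speedE => //; [exact: ltnW | move=> _; exact: ltW].
  rewrite /k -ss; apply: ddu => i im; have [ij|ij] := leqP i j.
    by rewrite gt_eqF // (le_lt_trans (hle _ _ ij (ltnW jn))).
  by rewrite lt_eqF // (lt_le_trans t2) // hle.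
have wave j b : (j < n)%N -> x j < b <= x j.+1 ->
    u' b + 'i * (k j)%:C * u b = cis (k j * (b - x j)) * (W j + 'i * (k j)%:C * u (x j)) /\
    u' b - 'i * (k j)%:C * u b = cis (- (k j * (b - x j))) * (W j - 'i * (k j)%:C * u (x j)).
  move=> jn /andP[xb bx]; apply: (wave_propagation xb).
  - move=> t /andP[t1 t2]; have H : x j < t < x j.+1 by rewrite t1 (lt_le_trans t2 bx).
    exact: (layer j t jn H).1.
  - move=> t /andP[t1 t2]; have H : x j < t < x j.+1 by rewrite t1 (lt_le_trans t2 bx).
    exact: (layer j t jn H).2.
  - exact/Ccvg_right/cu.
  - exact/Wright/ltnW.
  - exact/Ccvg_left/cu.
  - apply: Ccvg_left; have [|//] := du b.
    by rewrite gt_eqF // (le_lt_trans (hle 0%N j _ _) xb) // ltnW.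
have lE : l = - ('i * (k 0%N)%:C * u (x 0%N)).
  rewrite -mulNr -mulrN -rmorphN /=.
  apply: (@Ccvg_wave_limit _ _ u u' _ _ _ (at_left_proper_filter (x 0%N))) => //.
    exact/Ccvg_left/cu.
  near=> t; have tx : t < x 0%N by near: t; exact: nbhs_left_lt.
  apply: (@plane_wave_derive _ _ _ _ _ B).
    near=> s; rewrite mulNr; apply: uB; near: s; exact: lt_nbhsl.
  by have [] := du t; first by rewrite lt_eqF.
have WnE : W n = 'i * (k n)%:C * u (x n).
  apply: (@Ccvg_wave_limit _ _ u u' _ _ _ (at_right_proper_filter (x n))).
  - exact/Ccvg_right/cu.
  - exact: Wright.
  near=> t; have tx : x n < t by near: t; exact: nbhs_right_gt.
  apply: (@plane_wave_derive _ _ _ _ _ A).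
    near=> s; apply: uA; near: s; exact: lt_nbhsr.
  by have [] := du t; first by rewrite gt_eqF // (le_lt_trans (hle 0%N n _ _) tx).
pose P j := (schur_num (fun i => rc (j + i)%N) (n - j)).[z].
pose Q j := (schur_den (fun i => rc (j + i)%N) (n - j)).[z].
(* Equivalently (W + i k u) P + (W - i k u) Q = 0: in projective form, the ratio of left-moving to
   right-moving amplitude at [x j] is P/Q for the interfaces ahead. It holds at [x n], where only
   the outgoing wave is left, and is carried back to the source. *)
have inv j : (j <= n)%N -> W j * (P j + Q j) + 'i * (k j)%:C * u (x j) * (P j - Q j) = 0.
  move=> jn; rewrite -(subKn jn); elim: (n - j)%N (leq_subr j n) => [|i IH] im.
    rewrite subn0 WnE /P /Q subnn /schur_num /schur_den /= horner0 hornerC.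
    by rewrite add0r sub0r mulr1 mulrN1 subrr.
  have {}IH := IH (ltnW im).
  set m := (n - i.+1)%N; have em : (n - i)%N = m.+1 by rewrite /m subnSK.
  rewrite em in IH.
  have mn : (m < n)%N by rewrite /m; lia.
  have [e1 e2] := @wave m (x m.+1) mn (introT andP (conj (hx mn) (lexx _))).
  have W1 : W m.+1 = u' (x m.+1) by [].
  (* Equal travel times enter here: the phase of a layer depends on the frequency only. *)
  have th : k m * (x m.+1 - x m) = Delta0 * w.
    by rewrite -(hD (j := m.+1)) //= /k; field; rewrite gt_eqF // hc // ltnW.
  rewrite th in e1 e2.
  have zE : z = cis (Delta0 * w) ^+ 2 by rewrite cisX /z; congr cis; ring.
  have ciN := cisN (Delta0 * w); have ci0 := cis_neq0 (Delta0 * w).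
  have eP : P m = z * (P m.+1 + rc m * Q m.+1).
    rewrite /P -(subnSK mn) schur_numS addn0 !hornerE /Q.
    have E : schur_pair (fun i => rc (m + i.+1)%N) (n - m.+1) =
         schur_pair (fun i => rc (m.+1 + i)%N) (n - m.+1).
      by apply: eq_schur_pair => i' _; rewrite addnS.
    by rewrite /schur_num /schur_den E.
  have eQ : Q m = Q m.+1 + rc m * P m.+1.
    rewrite /Q -(subnSK mn) schur_denS addn0 !hornerE /P.
    have E : schur_pair (fun i => rc (m + i.+1)%N) (n - m.+1) =
         schur_pair (fun i => rc (m.+1 + i)%N) (n - m.+1).
      by apply: eq_schur_pair => i' _; rewrite addnS.
    by rewrite /schur_num /schur_den E.
  rewrite W1 in IH.
  rewrite eP eQ zE; move: (P m.+1) (Q m.+1) IH => p q IH.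
  move: e1 e2; rewrite ciN; move: (cis (Delta0 * w)) ci0 => ci ci0.
  move: (W m) (u (x m)) (u' (x m.+1)) (u (x m.+1)) IH => Wm um v y IH e1 e2.
  (* Passes from the wave number of one layer to that of the next; this identity is what determines
     r. *)
  have kk : (k m)%:C * (1 - rc m) = (k m.+1)%:C * (1 + rc m) :> R[i].
    rewrite -(rmorph1 (real_complex R)) /rc -rmorphB -rmorphD -!rmorphM /=; congr (_%:C).
    rewrite /reflection mn /k; field.
    have p1 := hc mn; have p2 := hc (ltnW mn).
    by rewrite !gt_eqF // addr_gt0.
  have E1 : Wm + 'i * (k m)%:C * um = ci^-1 * (v + 'i * (k m)%:C * y).
    by rewrite e1 mulrA mulVf // mul1r.
  have E2 : Wm - 'i * (k m)%:C * um = ci * (v - 'i * (k m)%:C * y).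
    by rewrite e2 mulrA mulfV // mul1r.
  transitivity ((Wm + 'i * (k m)%:C * um) * (ci ^+ 2 * (p + rc m * q)) +
    (Wm - 'i * (k m)%:C * um) * (q + rc m * p)); first by ring.
  rewrite E1 E2.
  transitivity (ci * ((1 + rc m) * (v * (p + q)) +
     'i * ((k m)%:C * (1 - rc m)) * y * (p - q))); first by field.
  rewrite kk.
  transitivity (ci * (1 + rc m) * (v * (p + q) + 'i * (k m.+1)%:C * y * (p - q))); first by ring.
  by rewrite IH mulr0.
have z1 : `|z| = 1 by apply: norm_cis.
have Q0 : (schur_den rc n).[z] != 0 by apply: (schur_den_neq0 n reflection_lt1 z1).
have := inv 0%N isT; rewrite /P /Q subn0 /= /W /= lE.
have [] := @wave 0%N xs hn; first by case/andP: hxs => -> /ltW ->.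
rewrite /W /= lE /surrogate dw -/(k 0%N).
set p := (schur_num _ n).[z]; set q := (schur_den _ n).[z]; rewrite -/q in Q0.
set th := k 0%N * (xs - x 0%N).
have -> : 2 * k 0%N * (xs - x 0%N) = th + th by rewrite /th; ring.
rewrite cisD cisN; have := cis_neq0 th; move: (cis th) => ci ci0 e1 e2 e3.
set a := 'i * (k 0%N)%:C * u xs in e1 e2; set b := 'i * (k 0%N)%:C * u (x 0%N) in e1 e2 e3.
(* The source strength and the absence of a right-moving wave before [x 0] fix the scale: [W 0] is
   -b - 1. *)
have b2 : 2 * b = - (1 + p / q).
  apply: (mulIf Q0); rewrite -[RHS]subr0 -e3; field.
  done.
have -> : - (2 * 'i * (k 0%N)%:C) * ci * u xs = - (2 * a) * ci by rewrite /a; ring.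
(* The term -ci is the direct wave; the subtraction in [surrogate] cancels it. *)
have -> : 2 * a = - ci + ci^-1 * (1 + 2 * b).
  transitivity ((u' xs + a) - (u' xs - a)); first by ring.
  rewrite e1 e2; ring.
rewrite b2; field.
by rewrite Q0 ci0.
Unshelve. all: by end_near. Qed.

End Solution.
End Scattering.

(** * The period *)

(** By Bezout, the exponents that send [zeta] to 1 are closed under gcd. *)
Lemma expr_biggcdn (F : fieldType) (zeta : F) n (S : pred 'I_n) :
  (forall i : 'I_n, S i -> zeta ^+ i.+1 = 1) -> zeta ^+ (\big[gcdn/0%N]_(i < n | S i) i.+1) = 1.
Proof.
move=> H; elim/big_ind: _ => [|a b ea eb|//]; first by rewrite expr0.
have [->|a0] := posnP a; first by rewrite gcd0n.
case: (egcdnP b a0) => ka kb e _.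
by have := congr1 (fun m => zeta ^+ m) e; rewrite exprD !(mulnC _ a) !(mulnC _ b) !exprM ea eb !expr1n mul1r.
Qed.

Section Period.
Variable R : realType.

Lemma itv_avoid (a b e : R) : a < b ->
  exists a' b', [/\ a <= a', a' < b', b' <= b & forall w, a' < w < b' -> w != e].
Proof.
move=> ab; have [em|em] := leP e ((a + b) / 2).
  exists ((a + b) / 2), b; split; [lra | lra | by [] |].
  by move=> w /andP[w1 w2]; rewrite gt_eqF // (le_lt_trans em).
exists a, ((a + b) / 2); split; [by [] | lra | lra |].
by move=> w /andP[w1 w2]; rewrite lt_eqF // (lt_trans w2).
Qed.

(** As many points as [size D] are placed within less than a full turn, so they are distinct roots,
    one more than the degree allows. The exceptional parameters serve the frequency 0 and its shift
    by a candidate period. *)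
Lemma poly_zero_on_arc (D : {poly R[i]}) (k a b e f : R) : 0 < k -> a < b ->
  (forall w, a < w < b -> w != e -> w != f -> D.[cis (k * w)] = 0) -> D = 0.
Proof.
move=> k0 ab H; apply/eqP; apply: contraT => Dn0.
have [a1 [b1 [aa1 ab1 bb1 n1]]] := itv_avoid e ab.
have [a2 [b2 [aa2 ab2 bb2 n2]]] := itv_avoid f ab1.
pose L := Num.min (b2 - a2) (2 * pi / k).
have L0 : 0 < L by rewrite /L lt_min subr_gt0 ab2 divr_gt0 // mulr_gt0 // pi_gt0.
have L1 : L <= b2 - a2 by rewrite /L ge_min lexx.
have L2 : k * L <= 2 * pi.
  by rewrite mulrC -ler_pdivlMr // /L ge_min lexx orbT.
pose M := size D.
pose wi (i : nat) := a2 + L * (i.+1%:R / M.+1%:R).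
have fr i : (i < M)%N -> 0 < (i.+1%:R / M.+1%:R : R) < 1.
  by move=> iM; rewrite divr_gt0 //= ltr_pdivrMr // mul1r ltr_nat.
have wiI i : (i < M)%N -> a2 < wi i < b2.
  move=> /fr /andP[f1 f2]; rewrite /wi; have : L * (i.+1%:R / M.+1%:R) < L by rewrite gtr_pMr.
  by have := mulr_gt0 L0 f1; move: (L * _) => t t0 tL; apply/andP; split; lra.
pose rs := [seq cis (k * wi i) : R[i] | i <- iota 0 M].
have rsD : all (root D) rs.
  rewrite /rs all_map; apply/allP => i; rewrite mem_iota add0n => /andP[_ iM]; apply/rootP.
  have /andP[w1 w2] := wiI i iM.
  have w12 : a1 < wi i < b1 by rewrite (le_lt_trans aa2) // (lt_le_trans w2).
  apply: H; last by apply: n2; rewrite w1.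
    by case/andP: w12 => w3 w4; rewrite (le_lt_trans aa1) // (lt_le_trans w4).
  exact: n1.
have key i j : (i < j)%N -> (j < M)%N -> cis (k * wi i) != cis (k * wi j) :> R[i].
  move=> ij jM; apply/eqP => E.
  have d0 : 0 < wi j - wi i.
    by rewrite /wi opprD addrACA subrr add0r -mulrBr -mulrBl mulr_gt0 // divr_gt0 // subr_gt0 ltr_nat.
  have d1 : wi j - wi i < L.
    have /andP[f1 f2] := fr j jM; have /andP[f3 f4] := fr i (ltn_trans ij jM).
    rewrite /wi opprD addrACA subrr add0r -mulrBr gtr_pMr //; move: f1 f2 f3 f4; move: (j.+1%:R / _) (i.+1%:R / _) => p q; lra.
  have c1 : cis (k * (wi j - wi i)) = 1 :> R[i].
    by rewrite mulrBr cisD cisN E mulfV // cis_neq0.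
  have := @cis_eq1 _ (k * (wi j - wi i)) _ c1; rewrite ltW ?mulr_gt0 //=.
  rewrite (lt_le_trans _ L2) ?ltr_pM2l // => /(_ isT) /eqP.
  by rewrite gt_eqF // mulr_gt0.
have urs : uniq rs.
  rewrite map_inj_in_uniq ?iota_uniq // => i j; rewrite !mem_iota !add0n => /andP[_ iM] /andP[_ jM] E.
  case: (ltngtP i j) => // ij; first by have := key _ _ ij jM; rewrite E eqxx.
  by have := key _ _ ij iM; rewrite E eqxx.
by have := max_poly_roots Dn0 rsD urs; rewrite size_map size_iota ltnn.
Qed.

Variables (s : nat -> R) (n : nat) (Delta0 wmin wmax : R) (rho : R -> R[i]).
Hypothesis s1 : forall i, `|s i| < 1.
Hypothesis D0 : 0 < Delta0.
Hypothesis hOmega : pi / Delta0 < wmax - wmin.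
Let sc i : R[i] := (s i)%:C.
Let z w : R[i] := cis (2 * Delta0 * w).
Hypothesis rhoE : forall w, wmin < w < wmax -> w != 0 ->
  rho w = (schur_num sc n).[z w] / (schur_den sc n).[z w].

Definition reflection_gcd := \big[gcdn/0%N]_(i < n | s i != 0) i.+1.

Let zD w y : z (w + y) = z y * z w.
Proof. by rewrite /z mulrDr cisD mulrC. Qed.

Let Qz w : (schur_den sc n).[z w] != 0.
Proof. by apply: schur_den_neq0 => //; apply: norm_cis. Qed.

Let sc1 i : sc i ^+ 2 != 1.
Proof.
rewrite /sc -rmorphXn -(rmorph1 (real_complex R)) (inj_eq (@complexI R)) lt_eqF //.
by rewrite -real_normK ?num_real // expr_lt1.
Qed.

Lemma rotation_invariant_periodic y :
  (forall i, (i < n)%N -> s i != 0 -> z y ^+ i.+1 = 1) ->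
  forall w, (schur_num sc n).[z (w + y)] / (schur_den sc n).[z (w + y)] =
            (schur_num sc n).[z w] / (schur_den sc n).[z w].
Proof.
move=> H w.
have /(congr1 (fun p : {poly R[i]} => p.[z w])) :
  1 *: ((schur_num sc n \Po (z y *: 'X)) * schur_den sc n) =
    schur_num sc n * (schur_den sc n \Po (z y *: 'X)).
  apply/schur_rotate => // i im si; rewrite mul1r; apply: H => //.
  by apply: contra_neq si => si; rewrite /sc si rmorph0.
rewrite scale1r !hornerM !horner_comp !hornerZ hornerX -zD => E.
have := Qz w; have := Qz (w + y); move: E.
move: (_.[z (w + y)]) (_.[z w]) (_.[z (w+y)]) (_.[z w]) => p q p' q' E q0 q'0.
by apply/eqP; rewrite eqr_div // E.
Qed.

(** As y < |Omega|, the frequencies w with w and w + y both in the interval fill an open interval.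
    Equality there forces a polynomial identity, to which [schur_rotate] applies. *)
Lemma alg_period_mem y : 0 < y < wmax - wmin ->
  (forall w, wmin < w < wmax -> wmin < w + y < wmax ->
      w != 0 -> w + y != 0 -> rho w = rho (w + y)) <->
  (forall i, (i < n)%N -> s i != 0 -> z y ^+ i.+1 = 1).
Proof.
move=> /andP[y0 yL]; split=> H; last first.
  move=> w w1 w2 w3 w4; rewrite !rhoE //.
  by rewrite rotation_invariant_periodic.
have : 1 *: ((schur_num sc n \Po (z y *: 'X)) * schur_den sc n) =
    schur_num sc n * (schur_den sc n \Po (z y *: 'X)).
  rewrite scale1r; apply/eqP; rewrite -subr_eq0; apply/eqP.
  have k0 : 0 < 2 * Delta0 by rewrite mulr_gt0.
  have ab : wmin < wmax - y by lra.
  apply: (@poly_zero_on_arc _ _ _ _ 0 (- y) k0 ab) => w /andP[w1 w2] w3 w4.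
  have e : w + y != 0 by rewrite addr_eq0.
  have i1 : wmin < w < wmax by apply/andP; split; lra.
  have i2 : wmin < w + y < wmax by apply/andP; split; lra.
  have := H w i1 i2 w3 e; rewrite !rhoE // => /eqP.
  rewrite eqr_div // => /eqP E.
  rewrite hornerD hornerN !hornerM !horner_comp !hornerZ hornerX -/(z w) -zD E mulrC subrr //.
move/schur_rotate => K i im si; rewrite -[LHS]mul1r; apply: K => //.
by rewrite /sc fmorph_eq0.
Qed.

Lemma reflection_gcd_dvd i : (i < n)%N -> s i != 0 -> (reflection_gcd %| i.+1)%N.
Proof.
by move=> im si; apply: (biggcdn_inf (Ordinal im)) => /=.
Qed.

(** The infimum is attained, since p <= pi/Delta0 < |Omega|. A smaller y would give z(y)^k = 1 with
    a phase strictly between 0 and 2 pi. *)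
Lemma alg_period_gcd : (exists2 i, (i < n)%N & s i != 0) ->
  (0 < reflection_gcd)%N /\ alg_period wmin wmax rho = pi / (reflection_gcd%:R * Delta0).
Proof.
move=> [i0 im0 si0]; set k := reflection_gcd.
have k0 : (0 < k)%N.
  by have := reflection_gcd_dvd im0 si0; rewrite -/k; case: k.
have kR : 0 < k%:R :> R by rewrite ltr0n.
have kD : 0 < k%:R * Delta0 by rewrite mulr_gt0.
split=> //; set p := pi / _.
have p0 : 0 < p by rewrite divr_gt0 // pi_gt0.
have pL : p < wmax - wmin.
  have Dk : Delta0 <= k%:R * Delta0 by apply: ler_peMl; [exact: ltW | rewrite ler1n].
  by apply: le_lt_trans hOmega; rewrite ler_pM2l ?pi_gt0 // lef_pV2 ?posrE.
rewrite /alg_period; set Y := (X in inf X).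
have Yp : Y p.
  split; first by rewrite p0.
  apply/alg_period_mem => [|i im si]; first by rewrite p0.
  have /dvdnP[q ->] := reflection_gcd_dvd im si.
  rewrite /z cisX -/k (_ : _ * _ = 2 * pi * q%:R) ?cis_2pin // natrM /p; field.
  by rewrite !gt_eqF.
have Yl y : Y y -> p <= y.
  move=> [/andP[y0 yL] /alg_period_mem]; rewrite y0 yL => /(_ isT) H.
  have : z y ^+ k = 1 by apply: expr_biggcdn => i; apply: H.
  rewrite /z cisX leNgt => c1; apply/negP => yp.
  have := cis_eq1 _ c1; rewrite mulr_ge0 ?mulr_ge0 ?ltW //= => /(_ _) e.
  have /e/eqP : k%:R * (2 * Delta0 * y) < 2 * pi.
    rewrite (_ : _ * _ = 2 * (y * (k%:R * Delta0))); last by ring.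
    by rewrite ltr_pM2l // -ltr_pdivlMr.
  by rewrite gt_eqF // !mulr_gt0.
apply/eqP; rewrite eq_le; apply/andP; split.
  by apply: ge_inf => //; exists p => y /Yl.
by apply: lb_le_inf; [exists p | move=> y /Yl].
Qed.

(** Without genuine interfaces every admissible shift is a period, and these accumulate at 0. *)
Lemma alg_period0 : wmin < wmax -> (forall i, (i < n)%N -> s i = 0) ->
  alg_period wmin wmax rho = 0.
Proof.
move=> hw s0; rewrite /alg_period; set Y := (X in inf X).
have L0 : 0 < wmax - wmin by rewrite subr_gt0.
have YE y : 0 < y < wmax - wmin -> Y y.
  move=> yL; split=> //; apply/alg_period_mem => // i im.
  by rewrite s0 ?eqxx.
have lb : lbound Y 0 by move=> y [/andP[/ltW]].
apply/eqP; rewrite eq_le; apply/andP; split; last first.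
  by apply: lb_le_inf => //; exists ((wmax - wmin) / 2); apply: YE; apply/andP; split; lra.
apply/ler_addgt0Pr => e e0; rewrite add0r.
apply: (@le_trans _ _ (Num.min e ((wmax - wmin) / 2))); last by rewrite ge_min lexx.
apply: ge_inf; first by exists 0.
apply: YE; rewrite lt_min e0 gt_min; apply/andP; split; first lra.
by apply/orP; right; lra.
Qed.

End Period.

(** * Layers of equal travel time *)

Section Layers.
Variables (R : realType) (n : nat) (c x : nat -> R) (Delta0 : R).
Hypothesis hn : (0 < n)%N.
Hypothesis hc : forall j, (j <= n)%N -> 0 < c j.
Hypothesis hx : forall j, (j < n)%N -> x j < x j.+1.
Hypothesis hD : forall j, (1 <= j <= n)%N -> (x j - x j.-1) / c j.-1 = Delta0.
Hypothesis D0 : 0 < Delta0.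

(* Layers of travel time [Delta0] continued past [x n] into the half-line of speed [c n] *)
Definition layer_speed i := c (minn i n).
Definition layer_start i := x 0%N + Delta0 * \sum_(l < i) layer_speed l.

Lemma layer_speed_gt0 i : 0 < layer_speed i.
Proof. by apply: hc; rewrite geq_minr. Qed.

Lemma layer_startS i : layer_start i.+1 = layer_start i + Delta0 * layer_speed i.
Proof. by rewrite /layer_start big_ord_recr mulrDr addrA. Qed.

Lemma layer_start_lt i j : (i < j)%N -> layer_start i < layer_start j.
Proof.
elim: j => [//|j IH]; rewrite ltnS leq_eqVlt layer_startS => /predU1P[->|/IH ij].
  by rewrite ltrDl mulr_gt0 // layer_speed_gt0.
by rewrite (lt_le_trans ij) // lerDl mulr_ge0 // ltW // layer_speed_gt0.
Qed.

Lemma layer_start_le i j : (i <= j)%N -> layer_start i <= layer_start j.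
Proof. by rewrite leq_eqVlt => /predU1P[-> //|/layer_start_lt /ltW]. Qed.

Lemma layer_startE i : (i <= n)%N -> layer_start i = x i.
Proof.
elim: i => [|i IH] im; first by rewrite /layer_start big_ord0 mulr0 addr0.
rewrite layer_startS IH ?(ltnW im) // -(hD (j := i.+1)) //= /layer_speed.
rewrite (minn_idPl (ltnW im)) divfK ?gt_eqF ?hc ?(ltnW im) //; ring.
Qed.

Lemma step_speed_layer i t : layer_start i < t <= layer_start i.+1 ->
  step_speed n c x t = layer_speed i.
Proof.
move=> /andP[t1 t2]; rewrite /layer_speed; apply: step_speedE => //; first exact: geq_minr.
  move=> _; rewrite -layer_startE ?geq_minr //; apply: le_lt_trans t1.
  by rewrite layer_start_le // geq_minl.
move=> im; have {}im : (i < n)%N by move: im; rewrite gtn_min ltnn orbF.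
by rewrite (minn_idPl (ltnW im)) -layer_startE.
Qed.

Lemma layer_of N t : layer_start 0 < t <= layer_start N ->
  exists2 i, (i < N)%N & layer_start i < t <= layer_start i.+1.
Proof.
elim: N => [|N IH] /andP[t1 t2]; first by have := lt_le_trans t1 t2; rewrite ltxx.
have [tN|tN] := leP t (layer_start N).
  by have [|i iN it] := IH; [rewrite t1 | exists i => //; rewrite ltnW].
by exists N; rewrite ?tN.
Qed.

Lemma layer_speed_reflection i :
  layer_speed i.+1 = layer_speed i * ((1 + reflection n c i) / (1 - reflection n c i)).
Proof.
rewrite /reflection /layer_speed; case: ifP => [im|/negbT im].
  rewrite (minn_idPl im) (minn_idPl (ltnW im)).
  have p1 := hc im; have p2 := hc (ltnW im).
  by field; rewrite !gt_eqF //; lra.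
rewrite -leqNgt in im.
by rewrite addr0 subr0 divr1 mulr1 (minn_idPr im) (minn_idPr (leqW im)).
Qed.

(** The half-open cells match those of [step_speed], so the integrand is constant on each.
    Measurability is carried along the induction, and the open interval is recovered at the end. *)
Lemma travel_time_layers N :
  travel_time (step_speed n c x) (x 0%N) (layer_start N) = N%:R * Delta0.
Proof.
pose f t := (step_speed n c x t)^-1.
have fE i t : t \in `]layer_start i, layer_start i.+1]%classic -> (layer_speed i)^-1 = f t.
  by rewrite mem_setE in_itv /= => h; rewrite /f (@step_speed_layer i).
have x0 : x 0%N = layer_start 0 by rewrite layer_startE.
have split_ i : `]layer_start 0, layer_start i.+1]%classic =
    (`]layer_start 0, layer_start i]%classic `|` `]layer_start i, layer_start i.+1]%classic).
  by apply: itv_bndbnd_setU; rewrite bnd_simp layer_start_le.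
have mf i : measurable_fun (`]layer_start i, layer_start i.+1]%classic : set R) f.
  by apply: (eq_measurable_fun (fun=> (layer_speed i)^-1)) => // t; apply: fE.
have [mN E] : measurable_fun (`]layer_start 0, layer_start N]%classic : set R) f /\
   (\int[@lebesgue_measure R]_(t in `]layer_start 0, layer_start N]) (f t)%:E = (N%:R * Delta0)%:E)%E.
  elim: N => [|N [mN E]].
    by rewrite set_itvoc0 mul0r integral_set0; split=> //; apply: measurable_fun_set0.
  have mN' : measurable_fun (`]layer_start 0, layer_start N.+1]%classic : set R) f.
    by rewrite split_; apply/measurable_funU.
  split=> //; rewrite split_ ge0_integral_setU //=.
  - rewrite E (eq_integral (fun=> ((layer_speed N)^-1)%:E)); last first.
      by move=> t ht; rewrite -(fE N t ht).
    rewrite integral_cst //= lebesgue_measure_itv /= lte_fin layer_start_lt //.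
    rewrite -EFinD layer_startS addrAC subrr add0r mulrCA mulVf ?gt_eqF ?layer_speed_gt0 //.
    by rewrite -natr1; congr (_%:E); ring.
  - by rewrite -split_; apply/measurable_EFinP.
  - move=> t ht; have {}ht : `]layer_start 0, layer_start N.+1]%classic t by rewrite split_.
    move: ht; rewrite /= in_itv /= => ht; have [i _ hi] := layer_of ht.
    by rewrite lee_fin /f (step_speed_layer hi) invr_ge0 ltW // layer_speed_gt0.
  - apply/disj_setPRL => t /=; rewrite !in_itv /= => /andP[h _] /andP[_ h'].
    by have := lt_le_trans h h'; rewrite ltxx.
rewrite /travel_time x0 /Rintegral integral_itv_bndo_bndc ?E //.
apply/measurable_EFinP; apply: measurable_funS mN => //; exact: subset_itv_oo_oc.
Qed.

Variable k : nat.
Hypothesis k0 : (0 < k)%N.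
Hypothesis hk : forall i, ~~ (k %| i.+1)%N -> reflection n c i = 0.

(** By [hk] the interfaces strictly inside a block of [k] layers are fictitious. *)
Lemma layer_speed_block j l : (l < k)%N -> layer_speed (k * j + l) = layer_speed (k * j).
Proof.
elim: l => [|l IH] lk; first by rewrite addn0.
rewrite addnS layer_speed_reflection hk; first by rewrite addr0 subr0 divr1 mulr1 IH // ltnW.
by rewrite -addnS dvdn_addr ?dvdn_mulr // gtnNdvd.
Qed.

Lemma layer_speed_blockS j : layer_speed (k * j.+1) = layer_speed (k * j) *
  ((1 + reflection n c (k * j.+1).-1) / (1 - reflection n c (k * j.+1).-1)).
Proof.
have e : (k * j.+1)%N = (k * j + k.-1).+1 by rewrite mulnS -addnS prednK // addnC.
by rewrite e layer_speed_reflection /= layer_speed_block // prednK.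
Qed.

Lemma layer_start_blockS j :
  layer_start (k * j.+1) = layer_start (k * j) + k%:R * Delta0 * layer_speed (k * j).
Proof.
have H l : (l <= k)%N ->
    layer_start (k * j + l) = layer_start (k * j) + l%:R * Delta0 * layer_speed (k * j).
  elim: l => [|l IH] lk; first by rewrite addn0 !mul0r addr0.
  by rewrite addnS layer_startS IH ?(ltnW lk) // layer_speed_block // -natr1; ring.
by rewrite mulnS addnC H.
Qed.

Lemma expR_artanh (r : R) : `|r| < 1 -> expR (2 * artanh r) = (1 + r) / (1 - r).
Proof.
rewrite ltr_norml => /andP[r1 r2]; rewrite /artanh mulrC divfK // lnK // posrE divr_gt0 //; lra.
Qed.

Variables (N : nat) (r : nat -> R[i]) (p : R).
Hypothesis hr : forall j, (j < N)%N -> complex.Re (r j.+1) = reflection n c (k * j.+1).-1.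
Hypothesis pE : pi / p = k%:R * Delta0.

Lemma alg_chat_layer j : (j <= N)%N -> alg_chat (c 0%N) r j = layer_speed (k * j).
Proof.
elim: j => [|j IH] jN.
  by rewrite /alg_chat big_geq // mulr0 expR0 mulr1 muln0 /layer_speed min0n.
rewrite layer_speed_blockS -IH ?(ltnW jN) // /alg_chat big_nat_recr //= mulrDr expRD mulrA.
by rewrite hr // expR_artanh // reflection_lt1.
Qed.

Lemma alg_xhat_layer j : (j <= N)%N ->
  alg_xhat (x 0%N) p (alg_chat (c 0%N) r) j = layer_start (k * j).
Proof.
elim: j => [|j IH] jN.
  by rewrite /alg_xhat big_geq // mulr0 addr0 muln0 layer_startE.
rewrite layer_start_blockS -IH ?(ltnW jN) // /alg_xhat big_nat_recr //= mulrDr addrA pE.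
by rewrite alg_chat_layer // ltnW.
Qed.

(** A point of the fine layer [i] lies in the coarse layer [i %/ k], where both speeds are constant
    and equal. The half-line beyond the last reconstructed jump is never reached. *)
Lemma step_speed_reconstruction t : (0 < N)%N ->
  x 0%N < t < layer_start (k * N) ->
  step_speed N (alg_chat (c 0%N) r) (alg_xhat (x 0%N) p (alg_chat (c 0%N) r)) t =
  step_speed n c x t.
Proof.
move=> N0 /andP[t1 t2].
have [|i iN it] := @layer_of (k * N) t; first by rewrite layer_startE // t1 ltW.
rewrite (step_speed_layer it); have /andP[i1 i2] := it.
have jN : (i %/ k < N)%N by rewrite ltn_divLR // mulnC.
have di := divn_eq i k; have mi := ltn_pmod i k0.
have -> : layer_speed i = layer_speed (k * (i %/ k)) by rewrite {1}di mulnC layer_speed_block.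
rewrite -(alg_chat_layer (ltnW jN)); apply: step_speedE => //.
- move=> j jN'; rewrite !alg_xhat_layer ?(ltnW jN') //; apply: layer_start_lt.
  by rewrite ltn_pmul2l.
- exact: ltnW.
- move=> _; rewrite alg_xhat_layer ?(ltnW jN) //; apply: le_lt_trans i1.
  by apply: layer_start_le; rewrite mulnC leq_trunc_div.
move=> _; rewrite alg_xhat_layer //; apply: le_trans i2 _; apply: layer_start_le.
by rewrite mulnC ltn_ceil.
Qed.

End Layers.

(** * Exactness *)

Lemma truncated_quotient_coef0 (F : fieldType) (s : nat -> F) L N :
  exists A : {poly F}, [/\ (size A <= N.+1)%N, A`_0 = 0 &
    'X^(N.+1) %| A * schur_den s L - schur_num s L].
Proof.
have Q0 : (schur_den s L)`_0 != 0 by rewrite schur_den0 oner_eq0.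
have [A sA hA] := truncated_quotient (schur_num s L) N.+1 Q0.
exists A; split=> //; have := dvd_Xn_coef hA (ltn0Sn N).
by rewrite coefB coef0M schur_den0 mulr1 schur_num0 subr0.
Qed.

Theorem mainTheorem2 (R : realType) (n : nat) (hn : (0 < n)%N)
    (c x : nat -> R) (xs Delta0 : R)
    (hc : forall j : nat, (j <= n)%N -> 0 < c j)
    (hx : forall j : nat, (j < n)%N -> x j < x j.+1)
    (hxs : x 0%N < xs < x 1%N)
    (hDelta0 : forall j : nat, (1 <= j <= n)%N ->
       (x j - x j.-1) / c j.-1 = Delta0)
    (u : R -> R -> R[i])
    (hu : forall w : R, w != 0 -> outgoing_solution n c x w (fun t => u t w))
    (wmin wmax : R) (hw : wmin < wmax)
    (hOmega : pi / Delta0 < wmax - wmin)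
    (d : R -> R[i])
    (hd : forall w : R, wmin < w < wmax -> w != 0 -> d w = u xs w)
    (N : nat) (hN : (1 <= N)%N) :
  let rho := surrogate (c 0%N) (x 0%N) xs in
  let p := alg_period wmin wmax (rho d) in
  let m := alg_moment (alg_alpha wmin p (rho d)) in
  [/\ (* the reflection coefficient has period pi / Delta0 *)
      forall w : R, w != 0 -> w + pi / Delta0 != 0 ->
        rho (u xs) (w + pi / Delta0) = rho (u xs) w,
      (* every step of the algorithm is well defined *)
      (exists2 j : nat, (j <= n)%N & c j != c 0%N) -> 0 < p,
      forall j : nat, (1 <= j <= N)%N ->
        [/\ rhat_den m (alg_nu m j.-1) j.-1 != 0,
            alg_rhat m j \is Num.real & `|alg_rhat m j| < 1]
    & (* exactness on (x 0, x 0 + S) *)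
      exists S : R,
        [/\ 0 <= S,
            travel_time (step_speed n c x) (x 0%N) (x 0%N + S) = N%:R * pi / p
          & forall t : R, x 0%N < t < x 0%N + S ->
              reconstruction (c 0%N) (x 0%N) xs wmin wmax N d t =
              step_speed n c x t]].
Proof.
move=> rho p m.
have D0 : 0 < Delta0.
  by rewrite -(hDelta0 1%N) ?hn //= divr_gt0 ?subr_gt0 ?hx ?hc.
pose s := reflection n c; pose sc i : R[i] := (s i)%:C.
have s1 i : `|s i| < 1 by apply: reflection_lt1.
have s0 i : (n <= i)%N -> s i = 0 by rewrite /s /reflection ltnNge => ->.
pose F w := (schur_num sc n).[cis (2 * Delta0 * w)] / (schur_den sc n).[cis (2 * Delta0 * w)].
have rhoE d' w : w != 0 -> d' w = u xs w -> rho d' w = F w.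
  by move=> w0 dw; rewrite /rho /F (outgoing_surrogate hn hc hx hxs hDelta0 (hu w w0) dw).
have rhodE w : wmin < w < wmax -> w != 0 -> rho d w = F w.
  by move=> wi w0; rewrite (rhoE d) // hd.
(* Shared by the two cases below. Padding to [n + N] parameters ensures that [geronimus] has N of
   them at its disposal. *)
have algP (s' : nat -> R) (A : {poly R}) : (forall i, `|s' i| < 1) -> A`_0 = 0 ->
    'X^(N.+1) %| A * schur_den s' (n + N) - schur_num s' (n + N) ->
    (forall j, (1 <= j <= N)%N -> alg_alpha wmin p (rho d) j = (A`_j)%:C) ->
    (forall j, (1 <= j <= N)%N ->
        [/\ rhat_den m (alg_nu m j.-1) j.-1 != 0,
            alg_rhat m j \is Num.real & `|alg_rhat m j| < 1]) /\
    (forall j, (j < N)%N -> alg_rhat m j.+1 = (s' j)%:C).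
  move=> s'1 A0 hA al.
  have K j (jN : (j < N)%N) := alg_nu_rhat s'1 (leq_addl n N) A0 hA al jN.
  split=> [[//|j] /= jN|j jN]; last by case: (K j jN).
  have [_ e1 e2] := K j jN; rewrite /alg_rhat /= -/m; rewrite -/m in e1 e2.
  rewrite e1 e2; split.
  - by rewrite fmorph_eq0 gt_eqF // wall_det_gt0.
  - by rewrite complex_real.
  - by rewrite normc_def /= expr0n addr0 sqrtr_sqr ltcR.
have per w : F (w + pi / Delta0) = F w.
  apply: (@rotation_invariant_periodic R s n Delta0 s1) => i im si.
  by rewrite (_ : 2 * Delta0 * _ = 2 * pi) ?cis_2pi ?expr1n //; field; rewrite gt_eqF.
have [/existsP[i0 si0]|/existsPn nos] := boolP [exists i : 'I_n, s i != 0]; last first.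
  have sz i : s i = 0.
    have [im|im] := ltnP i n; last exact: s0.
    by have /negPn/eqP := nos (Ordinal im).
  have p0 : p = 0.
    by apply: (alg_period0 s1 D0 rhodE hw) => i _; apply: sz.
  have H1 (i : nat) : `|0 : R| < 1 by rewrite normr0.
  have H2 : 'X^(N.+1) %| 0 * schur_den (fun=> 0 : R) (n + N) - schur_num (fun=> 0 : R) (n + N).
    have := @schur_pair_trailing R (fun=> 0) 0 (n + N) (fun _ _ => erefl).
    by rewrite /schur_num /schur_den add0n => ->; rewrite /= mul0r subrr dvdp0.
  (* Here [p^-1] is 0, so the coefficients vanish whatever the integrals are. *)
  have H3 j : (1 <= j <= N)%N -> alg_alpha wmin p (rho d) j = ((0 : {poly R})`_j)%:C.
    by move=> _; rewrite coef0 /alg_alpha p0 invr0 !rmorph0 mul0r.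
  have [a1 _] := algP (fun=> 0) 0 H1 (coef0 _ _) H2 H3.
  split=> //.
  - by move=> w w0 w1; rewrite !rhoE // per.
  - move=> [j jn /eqP[]]; elim: j jn => [//|j IH] jn.
    have := sz j; rewrite /s /reflection jn -(IH (ltnW jn)) => /eqP.
    have p1 := hc _ jn; have p2 := hc _ (ltnW jn).
    rewrite mulf_eq0 invr_eq0 subr_eq0 => /orP[/eqP //|].
    by rewrite gt_eqF // addr_gt0.
  (* With p = 0 the prescribed travel time [N%:R * pi / p] is 0. *)
  exists 0; split=> //.
    by rewrite addr0 /travel_time set_itvoo0 Rintegral_set0 p0 invr0 mulr0.
  by move=> t; rewrite addr0 => /andP[t1 t2]; have := lt_trans t1 t2; rewrite ltxx.
have [|k0 pE] := @alg_period_gcd R s n Delta0 wmin wmax (rho d) s1 D0 hOmega rhodE.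
  by exists (val i0); [exact: ltn_ord |].
rewrite -/p in pE; set k := reflection_gcd s n in k0 pE.
have kR : 0 < k%:R :> R by rewrite ltr0n.
have kD : 0 < k%:R * Delta0 by rewrite mulr_gt0.
have p0 : 0 < p by rewrite pE divr_gt0 ?pi_gt0.
have ppi : pi / p = k%:R * Delta0.
  by rewrite pE invf_div mulrCA divff ?mulr1 // gt_eqF ?pi_gt0.
have hk i : ~~ (k %| i.+1)%N -> s i = 0.
  move=> ki; have [im|] := ltnP i n; last exact: s0.
  by apply/eqP; apply: contraNT ki => si; apply: reflection_gcd_dvd.
(* The parameters of the medium seen in layers of travel time k Delta0. *)
pose s' i := s (k * i.+1).-1.
have s'1 i : `|s' i| < 1 by apply: s1.
have [A [sA A0 hA]] := truncated_quotient_coef0 s' (n + N) N.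
have Fk w : F w = (schur_num (fun i => (s' i)%:C) (n + N)).[cis (2 * (k%:R * Delta0) * w)] /
            (schur_den (fun i => (s' i)%:C) (n + N)).[cis (2 * (k%:R * Delta0) * w)].
  (* The [k * (n + N)] fine layers contain all [n] interfaces; the surplus parameters are 0. *)
  have le : (n <= k * (n + N))%N by rewrite (leq_trans (leq_addr N n)) // leq_pmull.
  have zk : cis (2 * (k%:R * Delta0) * w) = cis (2 * Delta0 * w) ^+ k :> R[i].
    by rewrite cisX; congr cis; ring.
  have sch : forall i, ~~ (k %| i.+1)%N -> sc i = 0.
    by move=> i /hk e; rewrite /sc e rmorph0.
  have [e1 e2] := schur_pair_horner_stretch (n + N) (cis (2 * Delta0 * w)) k0 sch.
  rewrite zk -e1 -e2 /F -{1 2}(subnKC le) /schur_num /schur_den.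
  rewrite schur_pair_trailing // => i ni.
  by rewrite /sc s0 ?rmorph0.
have [|a1 a2] := algP s' A s'1 A0 hA.
  move=> j /andP[_ jN].
  rewrite pE; apply: (fourier_coef s'1 kD sA hA _ jN) => w /andP[w1 w2] w0.
  rewrite rhodE ?Fk // w1 (lt_trans w2) //.
  (* The period of integration in Step 1 stays inside Omega, as p <= pi/Delta0 < |Omega|. *)
  rewrite -pE -ltrBrDl; apply: le_lt_trans hOmega.
  rewrite pE ler_pM2l ?pi_gt0 // lef_pV2 ?posrE //.
  by apply: ler_peMl; [exact: ltW | rewrite ler1n].
split=> //.
  by move=> w w0 w1; rewrite !rhoE // per.
(* The end of [N] coarse layers, that is, of [k * N] fine ones. *)
exists (layer_start n c x Delta0 (k * N) - x 0%N).
have x0E : layer_start n c x Delta0 0 = x 0%N by apply: layer_startE.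
split.
- by rewrite subr_ge0 -x0E layer_start_le.
- rewrite addrC subrK travel_time_layers // -[RHS]mulrA ppi natrM; ring.
move=> t; rewrite addrC subrK => ht; rewrite /reconstruction -/rho -/p -/m.
apply: (step_speed_reconstruction hn hc hx hDelta0 D0 k0 hk _ ppi hN ht) => j jN.
by rewrite a2.
Qed.
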